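(* Let $\mathcal{G}=(V,\mathcal{E},\mathcal{B})$ be an mDAG containing a bidirected facet $B=C\,\dot\cup\,D$ such that: (i) every bidirected face containing any $c\in C$ is a subset of $B$; and (ii) $\mathrm{pa}_{\mathcal{G}}(d)\supseteq \mathrm{pa}_{\mathcal{G}}(C)$ for each $d\in D$. Let $\mathcal{H}$ be the mDAG defined from $\mathcal{G}$ by removing the facet $B$ and replacing it with $C$ and $D$, and adding edges $c\to d$ for each $c\in C$ and $d\in D$ (where such an edge is not already present). Then $\mathcal{M}_m(\mathcal{G})=\mathcal{M}_m(\mathcal{H})$.
   Context: A DAG is a finite vertex set with directed edges $v\to w$ (ordered pairs of distinct vertices) and no directed cycles; $\mathrm{pa}(w)=\{v:v\to w\}$ and $\mathrm{pa}(A)=\bigcup_{a\in A}\mathrm{pa}(a)$. A simplicial complex on a finite set $V$ is a collection $\mathcal{B}$ of non-empty subsets of $V$ containing all singletons and closed under taking non-empty subsets; its inclusion-maximal elements are its facets, and $\bar{\mathcal{B}}$ denotes the set of non-trivial facets (those of size at least 2). An mDAG is a triple $(V,\mathcal{E},\mathcal{B})$ with $(V,\mathcal{E})$ a DAG and $\mathcal{B}$ a simplicial complex on $V$, whose elements are the bidirected faces; parents in an mDAG are those in the underlying DAG $(V,\mathcal{E})$. Replacing the facet $B$ by $C$ and $D$ means that the bidirected faces of $\mathcal{H}$ are the singletons and all non-empty subsets of $C$, of $D$, or of a facet of $\mathcal{G}$ other than $B$. The canonical DAG $\bar{\mathcal{G}}$ of $\mathcal{G}$ has vertex set $V\cup\bar{\mathcal{B}}$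 and edges $\mathcal{E}\cup\{B\to v: v\in B\in\bar{\mathcal{B}}\}$. Each vertex $v$ carries a random variable $X_v$ with values in a state-space $\mathcal{X}_v$; $\mathcal{X}_A=\prod_{v\in A}\mathcal{X}_v$ and $X_A=(X_v)_{v\in A}$. State-spaces are arbitrary except that all probability spaces are assumed to be Lebesgue–Rokhlin (standard) probability spaces. For a DAG $\mathcal{D}$ with vertex set $W$, $\mathcal{M}(\mathcal{D})$ is the set of probability distributions $P$ over $\mathcal{X}_W$ satisfying the structural equation property: there exist independent random variables $E_v$ ($v\in W$), with values in some spaces $\mathscr{E}_v$, and measurable functions $f_v:\mathcal{X}_{\mathrm{pa}(v)}\times\mathscr{E}_v\to\mathcal{X}_v$ such that recursively setting $X_v=f_v(X_{\mathrm{pa}(v)},E_v)$ gives $X_W$ the distribution $P$. If $\mathcal{D}$ has vertex set $V\,\dot\cup\,U$ and $\mathcal{X}_V$ is given, $\mathcal{M}(\mathcal{D},V)$ is the set of distributions $P$ over $\mathcal{X}_V$ for which there exist some state-space $\mathcal{X}_U$ and some $Q\in\mathcal{M}(\mathcal{D})$ over $\mathcal{X}_V\times\mathcal{X}_U$ whose margin over $X_V$ is $P$. The marginal model of an mDAG $\mathcal{G}$ with vertices $V$ is $\mathcal{M}_m(\mathcal{G})=\mathcal{M}(\bar{\mathcal{G}},V)$. Equality of models is for a common arbitrary state-space $\mathcal{X}_V$. *)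

(* Defs.v *)
From mathcomp Require Import all_boot all_order all_algebra.
From mathcomp Require Import all_classical all_reals all_analysis.
Set Implicit Arguments.
Unset Strict Implicit.
Unset Printing Implicit Defensive.
Import Order.TTheory GRing.Theory Num.Theory.

(* [cycle e p] allows repeated vertices and one-vertex cycles, so [acyclic]
   excludes all closed walks, self-loops included. *)
Definition acyclic (W : finType) (e : rel W) : Prop :=
  forall p : seq W, p != [::] -> ~~ cycle e p.

Record dag (W : finType) := Dag {
  edge :> rel W;
  edge_acyclic : acyclic edge }.

Definition parents (W : finType) (e : rel W) (w : W) : {set W} :=
  [set v | e v w].

Definition parents_of (W : finType) (e : rel W) (A : {set W}) : {set W} :=
  (\bigcup_(a in A) parents e a)%SET.

Definition simplicial_complex (V : finType) (F : {set {set V}}) : Prop :=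
  [/\ finset.set0 \notin F,
      forall v : V, [set v]%SET \in F
    & forall A A' : {set V},
        A \in F -> A' \subset A -> A' != finset.set0 -> A' \in F].

Record mdag (V : finType) := Mdag {
  mdag_dag :> dag V;
  faces : {set {set V}};
  faces_complex : simplicial_complex faces }.

Definition facets (V : finType) (G : mdag V) : {set {set V}} :=
  [set A | maxset [in faces G] A].

Definition nontrivial_facets (V : finType) (G : mdag V) : {set {set V}} :=
  [set A in facets G | 1 < #|A|].

Section Canonical.
Variables (V : finType) (G : mdag V).

Definition latent := {A : {set V} | A \in nontrivial_facets G}.

Definition canonical_edge (x y : V + latent) : bool :=
  match x, y with
  | inl v, inl w => G v w
  | inr A, inl v => v \in val A
  | _, inr _ => false
  end.

Lemma canonical_acyclic : acyclic canonical_edge.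
Proof.
move=> p p0; apply/negP => cp.
have noU (A : latent) : inr A \notin p.
  apply/negP => Ap; have := prev_cycle cp Ap.
  by case: (prev p _).
have [q pq] : exists q : seq V, p = map inl q.
  elim: p noU {p0 cp} => [|[v|A] p IH] noU; first by exists [::].
    have [|q ->] := IH; last by exists (v :: q).
    by move=> A; have := noU A; rewrite inE.
  by have := noU A; rewrite inE eqxx.
have q0 : q != [::] by move: p0; rewrite pq; case: (q).
have /negP := @edge_acyclic _ G _ q0; apply.
by move: cp; rewrite pq /cycle; case: (q) => //= x s; rewrite -map_rcons path_map.
Qed.

Definition canonical_dag : dag (V + latent)%type := Dag canonical_acyclic.

End Canonical.

Section Split.
Variables (V : finType) (G : mdag V) (B C D : {set V}).

Definition split_edge : rel V :=
  fun v w => G v w || (v \in C) && (w \in D).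

Definition split_faces : {set {set V}} :=
  [set A : {set V} | (A != finset.set0) &&
    [|| #|A| == 1, A \subset C, A \subset D
      | [exists F in facets G, (F != B) && (A \subset F)]]].

Lemma split_complex : simplicial_complex split_faces.
Proof.
split=> [|v|A A']; first by rewrite inE eqxx.
  by rewrite inE cards1 eqxx -card_gt0 cards1.
rewrite !inE => /andP[A0 HA] sA A'0; rewrite A'0 /=.
case/or4P: HA => [A1|AC|AD|/exists_inP[F FG /andP[FB AF]]].
- suff -> : A' = A by rewrite A1.
  apply/eqP; rewrite eqEcard sA (eqP A1) card_gt0; exact: A'0.
- by rewrite (fintype.subset_trans sA AC) orbT.
- by rewrite (fintype.subset_trans sA AD) !orbT.
- apply/or4P/Or44; apply/exists_inP; exists F => //.
  by rewrite FB (fintype.subset_trans sA AF).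
Qed.

Hypothesis CD : [disjoint C & D].
Hypothesis paCD :
  forall d, d \in D -> parents_of G C \subset parents G d.

Lemma split_acyclic : acyclic split_edge.
Proof.
move=> p p0; apply/negP => cp.
pose A : pred V := fun x => [exists c in C, connect G x c].
have DA d : d \in D -> ~~ A d.
  move=> dD; apply/negP => /exists_inP[c cC /connectP[s]].
  elim/last_ind: s => [|s y _] /=.
    by move=> _ cd; move: CD; rewrite disjoint_subset =>
      /fintype.subsetP/(_ _ cC); rewrite inE cd dD.
  rewrite rcons_path last_rcons => /andP[ps sy] cy.
  have : last d s \in parents G d.
    apply: (fintype.subsetP (paCD dD)); apply/bigcupP; exists c => //.
    by rewrite inE cy.
  rewrite inE => sd.
  have /negP := @edge_acyclic _ G _ (isT : d :: s != [::]); apply.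
  by rewrite /cycle rcons_path ps.
have back x y : split_edge x y -> A y -> A x.
  case/orP=> [xy /exists_inP[c cC yc]|/andP[_ yD] Ay].
    by apply/exists_inP; exists c => //; apply: connect_trans (connect1 xy) yc.
  by have := DA y yD; rewrite Ay.
have CA x : x \in C -> A x by move=> xC; apply/exists_inP; exists x.
have backs x s : path split_edge x s -> A (last x s) -> all A (x :: s).
  elim: s x => [|y s IH] x /=; first by move=> _ ->.
  move=> /andP[xy ys] /(IH _ ys) /= /andP[Ay ->].
  by rewrite Ay (back _ _ xy Ay).
have /negP := @edge_acyclic _ G _ p0; apply.
have [hA|nA] := boolP (has A p).
  have allA : all A p.
    have /hasP[x xp Ax] := hA.
    have [i s ps] := rot_to xp.
    move: cp; rewrite -(rot_cycle i) ps => /= /backs.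
    rewrite last_rcons => /(_ Ax) /=; rewrite all_rcons => /and3P[_ _ As].
    by apply/allP => y; rewrite -(mem_rot i) ps inE => /predU1P[->|/(allP As)].
  apply: (sub_in_cycle _ allA) cp => x y _ Ay /orP[//|/andP[_ yD]].
  by have := DA y yD; rewrite (Ay : A y).
have allA : all (predC A) p by rewrite all_predC.
apply: (sub_in_cycle _ allA) cp => x y Ax _ /orP[//|/andP[xC _]].
by have := CA x xC; rewrite (negPf (Ax : ~~ A x)).
Qed.

Definition split_mdag : mdag V :=
  Mdag (Dag split_acyclic) split_complex.

End Split.

Local Open Scope classical_set_scope.
Local Open Scope ereal_scope.

Record state_space := StateSpace {
  state_display : measure_display;
  state_type :> measurableType state_display }.

Definition product_sets (I : Type) (X : I -> state_space) :
    set (set (forall i, X i)) :=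
  \bigcup_i preimage_set_system setT (fun x : forall i, X i => x i)
              (@measurable _ (X i)).

Definition product_space (I : Type) (X : I -> state_space) :=
  g_sigma_algebraType (@product_sets I X).

(* Lebesgue-Rokhlin (standard) probability spaces: [T] is isomorphic modulo
   null sets to the line with a Borel probability measure, the isomorphism
   being [phi] on the conull set [A] and the measure the image of [mu].
   Sigma-algebras are not completed: the Lebesgue-Rokhlin space proper is the
   completion. *)
Definition standard_probability (R : realType) (d : measure_display)
    (T : measurableType d) (mu : probability T R) : Prop :=
  exists (A : set T) (phi : T -> R),
    [/\ measurable A, mu A = 1, measurable_fun A phi,
        {in A &, injective phi}
      & forall S : set T, measurable S -> S `<=` A -> measurable (phi @` S)].

Section Models.
Variable R : realType.

Definition independent (d : measure_display) (Omega : measurableType d)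
    (mu : probability Omega R) (W : finType) (Y : W -> state_space)
    (E : forall w, {mfun Omega >-> Y w}) : Prop :=
  forall (J : {set W}) (A : forall w, set (Y w)),
    (forall w, measurable (A w)) ->
    mu (\bigcap_(w in [set` J]) (E w @^-1` A w))
      = \prod_(w in J) mu (E w @^-1` A w).

Definition parent_space (W : finType) (D : dag W) (X : W -> state_space)
    (w : W) :=
  product_space (fun v : {v : W | v \in parents D w} => X (val v)).

(* The structural equation property.  As [D] is acyclic, the structural
   equations determine the [x w] from the [E w] by recursion. *)
Definition dag_model (W : finType) (D : dag W) (X : W -> state_space) :
    set (probability (product_space X) R) :=
  [set P : probability (product_space X) R |
    exists (Omega : state_space) (mu : probability Omega R)
      (Y : W -> state_space) (E : forall w, {mfun Omega >-> Y w})
      (f : forall w, {mfun (parent_space D X w * Y w)%type >-> X w})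
      (x : forall w, {mfun Omega >-> X w}),
    [/\ standard_probability mu /\
        (forall w, standard_probability (distribution mu (E w))),
        independent mu E,
        (forall w omega, x w omega =
           f w ((fun v => x (val v) omega) : parent_space D X w, E w omega)),
        (forall w, standard_probability (distribution mu (x w)))
      & forall S : set (product_space X), measurable S ->
          P S = mu [set omega | S (fun w => x w omega)]]].

Definition sum_family (V U : Type) (X : V -> state_space)
    (Z : U -> state_space) (w : V + U) : state_space :=
  match w with inl v => X v | inr u => Z u end.

Definition margin_left (V U : Type) (X : V -> state_space)
    (Z : U -> state_space) (x : product_space (sum_family X Z)) :
    product_space X :=
  fun v => x (inl v).

Definition latent_model (V U : finType) (D : dag (V + U)%type)
    (X : V -> state_space) : set (probability (product_space X) R) :=
  [set P : probability (product_space X) R |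
    exists (Z : U -> state_space)
      (Q : probability (product_space (sum_family X Z)) R),
      dag_model D Q /\
      forall S : set (product_space X), measurable S ->
        P S = Q (@margin_left V U X Z @^-1` S)].

Definition marginal_model (V : finType) (G : mdag V) (X : V -> state_space) :
    set (probability (product_space X) R) :=
  @latent_model V (latent G) (canonical_dag G) X.

End Models.

Arguments dag_model R {W} D X.
Arguments latent_model R {V U} D X.
Arguments marginal_model R {V} G X.

(* Main.v *)
(* Standard noise can be recoded by finitely many independent real variables,
   each seen by the vertices of one bidirected face.  From H to G: a vertex of D
   has the parents of C among its own, so once it also sees the noise of C it can
   recompute X_C instead of receiving it.  From G to H: let U be the noise seen by
   C.  Visiting C and pa(C) along the DAG, each value is a function of the earlier
   ones and either of U or of the remaining noise, so U is independent of the
   remaining noise given (X_C, X_pa(C)).  The vertices of D can therefore use, in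
   place of U, a fresh draw from its conditional distribution given
   (X_C, X_pa(C)), obtained from a shared uniform variable by inverting the
   conditional distribution function; this does not change the law of X_V since
   no vertex of C or pa(C) lies downstream of D. *)
Require Import Defs.
From mathcomp Require Import all_boot all_order all_algebra.
From mathcomp Require Import all_classical all_reals all_analysis.
From mathcomp Require Import measurable_realfun lra.
Set Implicit Arguments.
Unset Strict Implicit.
Unset Printing Implicit Defensive.
Import Order.TTheory GRing.Theory Num.Theory.
Import numFieldNormedType.Exports.
Local Open Scope classical_set_scope.
Local Open Scope ring_scope.
Local Open Scope ereal_scope.

(** The state spaces are arbitrary measurable spaces; only the laws on them are standard.
    Conditional independence is therefore stated event by event, with a separate version of each
    conditional probability, and the only conditional distribution ever inverted is that of one real
    variable: the finitely many noise variables seen by C are packed into a single number of [0,1]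
    by a ternary code. Versions at different levels are monotone only up to null sets, so the
    inversion uses countably many rational levels. A second obstacle is that the structural
    equations are required at every sample point, whereas codes of standard spaces are faithful only
    on a set of measure one. Integrals of [0,1]-valued functions are turned into measures of regions
    under a graph, so that identities between them can be checked on pi-systems. *)

Section Toolkit.
Context d d1 (T : measurableType d) (T1 : measurableType d1).

Definition mfun_of (f : T -> T1) (mf : measurable_fun setT f) : {mfun T >-> T1} :=
  mfun_Sub (mem_set mf).

Lemma measurable_preimage (f : T -> T1) (A : set T1) :
  measurable_fun setT f -> measurable A -> measurable (f @^-1` A).
Proof. by move=> mf mA; rewrite -[X in measurable X]setTI; exact: mf. Qed.

Lemma measure_unique_pi (R : realType) (G : set (set T))
    (m1 m2 : {measure set T -> \bar R}) :
  @measurable _ T = <<s G >> -> setI_closed G -> G setT ->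
  m1 setT < +oo -> (forall A, G A -> m1 A = m2 A) ->
  forall A, measurable A -> m1 A = m2 A.
Proof.
move=> mG GI GT m1oo m12.
apply: (measure_unique G (fun=> setT)) => //.
by rewrite bigcup_const.
Qed.

End Toolkit.

Lemma measure_unique_rect d1 d2 (T1 : measurableType d1)
    (T2 : measurableType d2) (R : realType)
    (m1 m2 : {measure set (T1 * T2) -> \bar R}) :
  m1 setT < +oo ->
  (forall A B, measurable A -> measurable B -> m1 (A `*` B) = m2 (A `*` B)) ->
  forall X, measurable X -> m1 X = m2 X.
Proof.
move=> m1oo m12.
apply: (measure_unique_pi (G := [set A `*` B | A in measurable & B in measurable])).
- exact: measurable_prod_measurableType.
- move=> _ _ [A1 mA1 [B1 mB1 <-]] [A2 mA2 [B2 mB2 <-]].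
  exists (A1 `&` A2); first exact: measurableI.
  by exists (B1 `&` B2); [exact: measurableI|rewrite setXI].
- by exists setT => //; exists setT => //; rewrite setXTT.
- by [].
- by move=> _ [A mA [B mB <-]]; exact: m12.
Qed.

Section Real.
Variable R : realType.

Lemma measure_unique_ray (m1 m2 : {measure set R -> \bar R}) :
  m1 setT < +oo -> m1 setT = m2 setT ->
  (forall r, m1 `]-oo, r[%classic = m2 `]-oo, r[%classic) ->
  forall A, measurable A -> m1 A = m2 A.
Proof.
move=> m1oo m12T m12.
(* The open rays are closed under intersection but omit [setT], which the pi-system must contain;
   hence the hypothesis on total masses. *)
pose G := [set A : set R | exists r, A = `]-oo, r[%classic] `|` [set setT].
apply: (measure_unique_pi (G := G)) => //.
- rewrite [LHS](RGenInftyO.measurableE R); apply/seteqP; split.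
    apply: smallest_sub; first exact: smallest_sigma_algebra.
    by move=> A GA; apply: sub_sigma_algebra; left.
  apply: smallest_sub; first exact: smallest_sigma_algebra.
  move=> A [[r ->]|->]; first by apply: sub_sigma_algebra; exists r.
  have [s0 sD _] := smallest_sigma_algebra setT (@RGenInftyO.G R).
  by rewrite -(setD0 setT); exact: sD.
- move=> _ _ [[r ->]|->] [[s ->]|->]; rewrite ?setIT ?setTI.
  + left; exists (Num.min r s); apply/seteqP; split => x /=; rewrite !in_itv/= lt_min.
      by case=> -> ->.
    by case/andP.
  + by left; exists r.
  + by left; exists s.
  + by right.
- by right.
- by move=> A [[r ->]|->].
Qed.

(** [uniform_prob] lives on [measurableTypeR R]; the identity carries it to the measurable structure
    that [R] has elsewhere. *)
Definition unif : probability R R :=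
  distribution (uniform_prob (@ltr01 R))
    (mfun_of (@measurable_id _ (measurableTypeR R) setT :
      @measurable_fun _ _ (measurableTypeR R) R setT id)).

Lemma unif_ray (t : R) : (0 <= t <= 1)%R -> unif [set w | (w < t)%R] = t%:E.
Proof.
move=> /andP[t0 t1]; rewrite /unif /distribution /pushforward /= preimage_id.
have mray : measurable ([set w | (w < t)%R] : set (measurableTypeR R)).
  by rewrite -set_itvNyo; exact: measurable_itv.
rewrite -[X in uniform_prob _ X]setIT -integral_indic//= integral_uniform//=.
- rewrite subr0 invr1 mul1e integral_indic//=.
  rewrite (_ : _ `&` _ = (`[0%R, t[%classic : set R)).
    rewrite lebesgue_measure_itv/= lte_fin.
    by case: ltgtP t0 => // [t0 _|<-//]; rewrite oppr0 adde0.
  apply/seteqP; split => x /=; rewrite !in_itv/=.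
    by move=> [-> /andP[-> _]].
  by move=> /andP[-> xt]; rewrite xt (le_trans (ltW xt)).
- exact/measurable_EFinP/measurable_indic.
Qed.
End Real.

(** * Densities and change of variables *)

Section Density.
Context (R : realType) d (T : measurableType d) (P : probability T R).

Lemma bounded_density (m : {measure set T -> \bar R}) :
  (forall B, measurable B -> m B <= P B) ->
  exists g : T -> R, [/\ measurable_fun setT g, forall x, (0 <= g x <= 1)%R
    & forall B, measurable B -> m B = \int[P]_(x in B) (g x)%:E].
Proof.
move=> mP.
have mT : m setT < +oo.
  by rewrite (le_lt_trans (mP _ _))//= probability_setT ltry.
pose m' : {finite_measure set T -> \bar R} := mfrestr measurableT mT.
have m'E B : m' B = m B by rewrite /m'/= /mfrestr /mrestr setIT.
have domP : m' `<< P.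
  apply/null_content_dominatesP => A mA PA0.
  by apply/eqP; rewrite eq_le measure_ge0 andbT -PA0 m'E; exact: mP.
have [f [f0 ffin fint fE]] := radon_nikodym_sigma_finite domP.
have mf' : measurable_fun setT f by exact: measurable_int fint.
pose g x := Num.min 1%R (fine (f x)).
have mg : measurable_fun setT g.
  by apply: measurable_minr => //; exact: measurableT_comp.
have g01 x : (0 <= g x <= 1)%R.
  by rewrite /g le_min ler01 fine_ge0//= ge_min lexx.
exists g; split => // B mB.
(* On subsets of [N], [m <= P] while [P] is at most the integral of [f], which is [m]. So both agree
   there, and cutting [f] at 1 changes no integral; the bound on [g] then holds everywhere, not just
   almost everywhere. *)
pose N := [set x | 1 < f x].
have mN : measurable N.
  by rewrite /N -[X in measurable X]setTI; exact: emeasurable_fun_o_infty.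
have mg' D : measurable_fun D (fun x => (g x)%:E).
  exact/measurable_EFinP/measurable_funTS.
have mfD D : measurable_fun D f by exact: measurable_funTS.
have BE : B = (B `&` N) `|` (B `\` N) by rewrite setUIDK.
have disj : [disjoint B `&` N & B `\` N].
  by apply/disj_setPS => x [[_ Nx] [_ /(_ Nx)]].
have mBN : measurable (B `&` N) by exact: measurableI.
have mBD : measurable (B `\` N) by exact: measurableD.
rewrite [RHS](_ : _ = \int[P]_(x in (B `&` N) `|` (B `\` N)) (g x)%:E); last by rewrite -BE.
rewrite ge0_integral_setU//=; last by move=> x _; rewrite lee_fin; case/andP: (g01 x).
rewrite -m'E fE// [LHS](_ : _ = \int[P]_(x in (B `&` N) `|` (B `\` N)) f x); last by rewrite -BE.
rewrite ge0_integral_setU//=; congr (_ + _).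
  have -> : \int[P]_(x in B `&` N) (g x)%:E = P (B `&` N).
    rewrite -[RHS]mul1e -integral_cst//; apply: eq_integral => x /[!inE] -[_ Nx].
    rewrite /g /=; congr EFin; apply/min_idPl.
    by rewrite -lee_fin fineK// ltW.
  apply/eqP; rewrite eq_le -fE// m'E mP//= -m'E fE//.
  rewrite -[leLHS]mul1e -integral_cst//; apply: ge0_le_integral => //.
  by move=> x [_ Nx]; exact: ltW.
apply: eq_integral => x /[!inE] -[_ /negP]; rewrite -leNgt => fx1.
rewrite /g (_ : Num.min _ _ = fine (f x)) ?fineK//; apply/min_idPr.
by rewrite -lee_fin fineK.
Qed.

End Density.

Section ChangeOfVariables.
Context (R : realType) d (T : measurableType d) (P : probability T R).

(** Change of variables holds for the canonical Radon-Nikodym derivative [h], and [h] equals [f]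
    almost everywhere because both integrate to [m] over every measurable set. *)
Lemma ge0_integral_density (m : {measure set T -> \bar R}) (f g : T -> R) (A : set T) :
  measurable_fun setT f -> (forall x, (0 <= f x <= 1)%R) ->
  (forall B, measurable B -> m B = \int[P]_(x in B) (f x)%:E) ->
  measurable_fun setT g -> (forall x, (0 <= g x)%R) -> measurable A ->
  \int[m]_(x in A) (g x)%:E = \int[P]_(x in A) (g x * f x)%:E.
Proof.
move=> mf f01 mE mg g0 mA.
have mef D : measurable_fun D (EFin \o f) by exact/measurable_EFinP/measurable_funTS.
have meg D : measurable_fun D (EFin \o g) by exact/measurable_EFinP/measurable_funTS.
have mP B : measurable B -> m B <= P B.
  move=> mB; rewrite mE// -[leRHS]mul1e -integral_cst//; apply: ge0_le_integral => //.
  - by move=> x _; rewrite lee_fin; case/andP: (f01 x).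
  - by move=> x _; rewrite lee_fin; case/andP: (f01 x).
have mT : m setT < +oo by rewrite (le_lt_trans (mP _ _))//= probability_setT ltry.
pose m' : {finite_measure set T -> \bar R} := mfrestr measurableT mT.
have m'E B : m' B = m B by rewrite /m'/= /mfrestr /mrestr setIT.
have domP : m' `<< P.
  apply/null_content_dominatesP => B mB PB0.
  by apply/eqP; rewrite eq_le measure_ge0 andbT -PB0 m'E; exact: mP.
pose h := Radon_Nikodym_SigmaFinite.f m' P.
have hint : P.-integrable setT h by exact: Radon_Nikodym_SigmaFinite.f_integrable.
have mh : measurable_fun setT h by exact: measurable_int hint.
have hf : ae_eq P setT h (EFin \o f).
  apply: integral_ae_eq => // B _ mB.
  transitivity (m' B); last exact: etrans (m'E B) (mE B mB).
  exact/esym/Radon_Nikodym_SigmaFinite.f_integral.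
rewrite (eq_measure_integral m') => [|B mB _]; last exact/esym/m'E.
rewrite -(Radon_Nikodym_SigmaFinite.change_of_variables domP)//.
apply: ae_eq_integral => //.
- by apply: emeasurable_funM => //; exact: measurable_funTS.
- by under eq_fun do rewrite EFinM; apply: emeasurable_funM.
- apply: (@ae_eq_subset _ _ _ _ _ setT) => //.
  exact: (ae_eqe_mul2l (EFin \o g) hf).
Qed.

Lemma ge0_integral_mrestr (g : T -> R) (A B : set T) (mB : measurable B) :
  measurable_fun setT g -> (forall x, (0 <= g x)%R) -> measurable A ->
  \int[mrestr P mB]_(x in A) (g x)%:E = \int[P]_(x in A `&` B) (g x)%:E.
Proof.
move=> mg g0 mA.
rewrite (@ge0_integral_density _ (\1_B) g)//.
- rewrite integral_mkcondr; apply: eq_integral => x _.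
  by rewrite EFinM epatch_indic.
- by move=> x; rewrite indicE; case: (x \in B); rewrite ?lexx ?ler01.
- by move=> C mC; rewrite integral_indic// /mrestr/= setIC.
Qed.

End ChangeOfVariables.

Definition image_measure (R : realType) d d' (T : measurableType d)
    (T' : measurableType d') (m : {measure set T -> \bar R})
    (f : {mfun T >-> T'}) : {measure set T' -> \bar R} :=
  measure_function_pushforward__canonical__measure_function_Measure m
    (measurable_funPT f).

Lemma image_measureE (R : realType) d d' (T : measurableType d)
    (T' : measurableType d') (m : {measure set T -> \bar R})
    (f : {mfun T >-> T'}) A : image_measure m f A = m (f @^-1` A).
Proof. by []. Qed.

Lemma ge0_integral_image (R : realType) d d' (T : measurableType d)
    (T' : measurableType d') (m : {measure set T -> \bar R})
    (f : {mfun T >-> T'}) (g : T' -> R) (A : set T') :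
  measurable_fun setT g -> (forall x, (0 <= g x)%R) -> measurable A ->
  \int[image_measure m f]_(x in A) (g x)%:E = \int[m]_(x in f @^-1` A) (g (f x))%:E.
Proof.
move=> mg g0 mA.
rewrite (ge0_integral_pushforward (measurable_funPT f) m mA (f := EFin \o g))//.
- exact/measurable_EFinP/measurable_funTS.
- by move=> y _; rewrite lee_fin.
Qed.

(** * Conditional independence and resampling *)

Section CondIndep.
Context (R : realType) d (Omega : measurableType d) (mu : probability Omega R).

Definition below (h : Omega -> R) : set (Omega * R) := [set z | (z.2 < h z.1)%R].

Lemma measurable_below h : measurable_fun setT h -> measurable (below h).
Proof.
move=> mh; rewrite (_ : below h =
  (fun z : Omega * R => (z.2 < h z.1)%R) @^-1` [set true]).
  apply: measurable_preimage => //; apply: measurable_fun_ltr => //.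
  exact: (measurableT_comp mh).
by apply/seteqP; split => z.
Qed.

(** The fibre of the region over [x] has uniform mass [h x]. An integral thus becomes a measure of a
    set, to which the uniqueness lemmas apply. *)
Lemma product_below (A : set Omega) (h : Omega -> R) :
  measurable A -> measurable_fun setT h -> (forall x, (0 <= h x <= 1)%R) ->
  (mu \x unif R) (fst @^-1` A `&` below h) = \int[mu]_(x in A) (h x)%:E.
Proof.
move=> mA mh h01; rewrite /product_measure1 [RHS]integral_mkcond.
apply: eq_integral => x _; rewrite patchE /=; case: ifPn => [/set_mem|/negP] Ax.
  rewrite -unif_ray//; congr (unif R _); apply/seteqP; split => w.
    by move=> /xsectionP[].
  by move=> wh; apply/xsectionP; split.
rewrite -[RHS](measure0 (unif R)); congr (unif R _).
by apply/seteqP; split => w // /xsectionP[/= Ax' _]; apply: Ax; exact: mem_set.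
Qed.

Section Def.
Context dU dE dS (TU : measurableType dU) (TE : measurableType dE)
  (TS : measurableType dS).

(** [G (S w)] is a version of the conditional probability of [a] given [(S, E)]; that it depends on
    [S] alone is the independence. [G] is chosen for each [a] separately, so no regular conditional
    distribution enters. *)
Definition cond_indep (U : Omega -> TU) (E : Omega -> TE) (S : Omega -> TS) :=
  forall a, measurable a -> exists G : TS -> R,
    [/\ measurable_fun setT G, forall s, (0 <= G s <= 1)%R
      & forall W : set (TS * TE), measurable W ->
        mu (U @^-1` a `&` (fun w => (S w, E w)) @^-1` W) =
        \int[mu]_(w in (fun w => (S w, E w)) @^-1` W) (G (S w))%:E].

End Def.

(** [G] is the density, with respect to the law of [S], of that law restricted to the event [e].
    Both sides are measures of [W], and on a rectangle [B * a] both equal the integral over [B] of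
    the product of the two conditional probabilities, which is symmetric. *)
Lemma cond_indep_sym dU dE dS (TU : measurableType dU) (TE : measurableType dE)
    (TS : measurableType dS) (U : {mfun Omega >-> TU}) (E : {mfun Omega >-> TE})
    (S : {mfun Omega >-> TS}) :
  cond_indep U E S -> cond_indep E U S.
Proof.
move=> UES e me.
have mSp d' (T' : measurableType d') (Y : {mfun Omega >-> T'}) :
    measurable_fun setT (fun w => (S w, Y w)) by exact: measurable_fun_pair.
have mEe : measurable (E @^-1` e) by exact: measurable_funPTI.
pose mE := image_measure (mrestr mu mEe) S.
have mE_le B : measurable B -> mE B <= distribution mu S B.
  move=> mB; apply: le_measure; rewrite ?inE.
  - by apply: measurableI => //; exact: measurable_funPTI.
  - exact: measurable_funPTI.
  - by move=> ? [].
have [G [mG G01 GE]] := bounded_density mE_le.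
exists G; split => // W mW.
have G0 x : (0 <= G x)%R by case/andP: (G01 x).
have mGS : measurable_fun setT (G \o S) by exact: measurableT_comp.
have GS01 x : (0 <= (G \o S) x <= 1)%R by exact: G01.
pose SU := mfun_of (mSp _ _ U).
have mSU : measurable_fun setT (SU \o @fst Omega R) by exact: measurableT_comp.
pose lhs := image_measure (mrestr mu mEe) SU.
pose rhs := image_measure (mrestr (mu \x unif R) (measurable_below mGS)) (mfun_of mSU).
rewrite setIC -[LHS]/(lhs W).
rewrite -(product_below _ mGS)//; last exact: (measurable_preimage (mSp _ _ U) mW).
rewrite -[RHS]/(rhs W).
apply: measure_unique_rect mW.
  apply: le_lt_trans (ltry 1); rewrite -[leRHS](@probability_setT _ _ _ mu).
  apply: le_measure; rewrite ?inE//.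
  by apply: measurableI => //; exact: measurable_funPTI.
move=> B a mB ma.
have mUa : measurable (U @^-1` a) by exact: measurable_funPTI.
have [F [mF F01 FE]] := UES a ma.
have F0 x : (0 <= F x)%R by case/andP: (F01 x).
have mSB : measurable (S @^-1` B) by exact: measurable_funPTI.
have lhsE : lhs (B `*` a) = \int[distribution mu S]_(s in B) (F s * G s)%:E.
  transitivity (mu (U @^-1` a `&` (fun w => (S w, E w)) @^-1` (B `*` e))).
    rewrite /lhs image_measureE /mrestr; congr (mu _).
    by apply/seteqP; split => w /=; tauto.
  rewrite FE; last exact: measurableX.
  rewrite -(ge0_integral_density mG G01 GE)// ge0_integral_image//.
  rewrite (ge0_integral_mrestr mu mEe (g := F \o S))//.
    exact: measurableT_comp.
  by move=> x; exact: F0.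
have rhsE : rhs (B `*` a) = \int[distribution mu S]_(s in B) (G s * F s)%:E.
  transitivity (\int[mu]_(w in S @^-1` B `&` U @^-1` a) (G (S w))%:E).
    by rewrite -(product_below (measurableI _ _ mSB mUa) mGS GS01).
  pose mU := image_measure (mrestr mu mUa) S.
  have mUE B' : measurable B' -> mU B' = \int[distribution mu S]_(s in B') (F s)%:E.
    move=> mB'; rewrite (ge0_integral_image mu S)//.
    transitivity (mu (U @^-1` a `&` (fun w => (S w, E w)) @^-1` (B' `*` setT))).
      rewrite /mU image_measureE /mrestr; congr (mu _).
      by apply/seteqP; split => w /=; tauto.
    rewrite FE; last exact: measurableX.
    congr integral; apply/seteqP; split => w //=; tauto.
  rewrite -(ge0_integral_density mF F01 mUE)// ge0_integral_image//.
  rewrite (ge0_integral_mrestr mu mUa (g := G \o S))//.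
  by move=> x; exact: G0.
by rewrite lhsE rhsE; apply: eq_integral => x _; rewrite mulrC.
Qed.

(** [(S', E)] and [(S, E)] determine each other, so conditioning on either is the same, and the old
    [G], read through [r], is a function of [S']. *)
Lemma cond_indep_refine dU dE dS dS' (TU : measurableType dU) (TE : measurableType dE)
    (TS : measurableType dS) (TS' : measurableType dS')
    (U : Omega -> TU) (E : Omega -> TE) (S : Omega -> TS) (S' : Omega -> TS')
    (r : TS' -> TS) (k : TS * TE -> TS') :
  measurable_fun setT r -> measurable_fun setT k ->
  (forall w, S w = r (S' w)) -> (forall w, S' w = k (S w, E w)) ->
  cond_indep U E S -> cond_indep U E S'.
Proof.
move=> mr mk SE S'E UES a ma.
have [G [mG G01 GE]] := UES a ma.
exists (G \o r); split => [|s|W mW]; [exact: measurableT_comp|exact: G01|].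
pose W' := (fun z : TS * TE => (k z, z.2)) @^-1` W.
have mW' : measurable W'.
  by apply: measurable_preimage => //; exact: measurable_fun_pair.
have WE : (fun w => (S' w, E w)) @^-1` W = (fun w => (S w, E w)) @^-1` W'.
  by apply/seteqP; split => w; rewrite /W' /= S'E.
by rewrite WE GE//; apply: eq_integral => x _; rewrite /= -SE.
Qed.

Lemma cond_indep_cst dU dE dS (TU : measurableType dU) (TE : measurableType dE)
    (TS : measurableType dS) (U : {mfun Omega >-> TU}) (E : {mfun Omega >-> TE}) (s : TS) :
  (forall a e, measurable a -> measurable e ->
    mu (U @^-1` a `&` E @^-1` e) = mu (U @^-1` a) * mu (E @^-1` e)) ->
  cond_indep U E (fun=> s).
Proof.
move=> UE a ma; have mUa : measurable (U @^-1` a) by exact: measurable_funPTI.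
have fU : mu (U @^-1` a) \is a fin_num by exact: fin_num_measure.
exists (fun=> fine (mu (U @^-1` a))); split => //.
  by move=> _; rewrite fine_ge0//= -lee_fin fineK// probability_le1.
move=> W mW; pose e := xsection W s.
have me : measurable e by exact: measurable_xsection.
have -> : (fun w => (s, E w)) @^-1` W = E @^-1` e.
  by apply/seteqP; split => w /=; [move=> ?; apply/xsectionP|move=> /xsectionP].
by rewrite UE// integral_cst ?fineK//; exact: measurable_funPTI.
Qed.

End CondIndep.

Section Resampling.
Context (R : realType) d (Omega : measurableType d) (mu : probability Omega R)
  dE dS (TE : measurableType dE) (TS : measurableType dS)
  (U : {mfun Omega >-> R}) (E : {mfun Omega >-> TE}) (S : {mfun Omega >-> TS}).
Hypothesis U01 : forall w, (0 <= U w <= 1)%R.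
Hypothesis UES : cond_indep mu U E S.

Let rational (n : nat) : R := if unpickle n is Some q then ratr q else 0%R.

Let rational_dense (x y : R) : (x < y)%R -> exists n, (x < rational n < y)%R.
Proof.
move=> xy; have [q qxy] := rat_in_itvoo xy.
exists (pickle q); rewrite /rational pickleK.
by move: qxy; rewrite in_itv.
Qed.

Let M : {measure set (Omega * R) -> \bar R} := mu \x unif R.

Let SE w := (S w, E w).

Let mSE : measurable_fun setT SE.
Proof. exact: measurable_fun_pair. Qed.

(** Rational levels keep the quantile measurable, and confine to one null set the failures of
    monotonicity of [G] in its level. *)
Let candidates (G : R -> TS -> R) (z : TS * R) : set R :=
  [set 1%R] `|` [set x | exists n, [/\ (0 <= rational n <= 1)%R,
    (z.2 < G (rational n) z.1)%R & x = rational n]].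

(* The value at [z.2] of the inverse of the conditional distribution function
   [r |-> G r z.1], capped at 1 so that the infimum is never over the empty set. *)
Let quantile G z := inf (candidates G z).

Let candidates_inf G z : has_inf (candidates G z).
Proof.
split; first by exists 1%R; left.
by exists 0%R => x [->//|[n [/andP[n0 _] _ ->]]].
Qed.

Let quantile_le1 G z : (quantile G z <= 1)%R.
Proof. by apply: ge_inf; [have [] := candidates_inf G z|left]. Qed.

Let quantile_lt G z r : (r <= 1)%R -> (quantile G z < r)%R <->
  exists n, [/\ (0 <= rational n <= 1)%R, (rational n < r)%R
    & (z.2 < G (rational n) z.1)%R].
Proof.
move=> r1; split => [/inf_lt[]|].
- by have [] := candidates_inf G z.
- move=> x [->|[n [n01 zn ->]] nr]; first by rewrite ltNge r1.
  by exists n.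
- move=> [n [n01 nr zn]]; apply: le_lt_trans nr.
  apply: ge_inf; first by have [] := candidates_inf G z.
  by right; exists n.
Qed.

Let measurable_quantile G : (forall r, measurable_fun setT (G r)) ->
  measurable_fun setT (quantile G).
Proof.
move=> mG; apply: (measurability _ (RGenInftyO.measurableE R)).
move=> _ [_ [r ->] <-]; rewrite setTI.
have [r1|r1] := leP r 1%R; last first.
  rewrite (_ : _ @^-1` _ = setT)//; apply/seteqP; split => z //= _.
  by rewrite in_itv/=; exact: le_lt_trans (quantile_le1 _ _) r1.
rewrite (_ : _ @^-1` _ = \bigcup_n [set z : TS * R |
   [/\ (0 <= rational n <= 1)%R, (rational n < r)%R & (z.2 < G (rational n) z.1)%R]]).
  apply: bigcupT_measurable => n.
  have [n01|n01] := boolP (0 <= rational n <= 1)%R; last first.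
    by rewrite (_ : mkset _ = set0)//; apply/seteqP; split => z // [].
  have [nr|nr] := boolP (rational n < r)%R; last first.
    by rewrite (_ : mkset _ = set0)//; apply/seteqP; split => z // [].
  rewrite (_ : mkset _ = (fun z : TS * R => (z.2 < G (rational n) z.1)%R) @^-1` [set true]).
    apply: measurable_preimage => //; apply: measurable_fun_ltr => //.
    exact: (measurableT_comp (mG _)).
  by apply/seteqP; split => z; [move=> []|].
apply/seteqP; split => z /=; rewrite in_itv/=.
  by move/(quantile_lt _ _ r1) => [n ?]; exists n.
by move=> [n _ ?]; apply/(quantile_lt _ _ r1); exists n.
Qed.

(** Given [S = s], the quantile of a uniform variable has distribution function [r |-> G r s] up to
    null sets, and [E] does not enter since [G] sees only [S]. Uniqueness on rectangles, then on
    rays, reduces the claim to [eq_ray]. *)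
Lemma conditional_resampling :
  exists g : TS * R -> R, measurable_fun setT g /\
    forall W : set ((TS * TE) * R), measurable W ->
      (mu \x unif R) [set z | W ((S z.1, E z.1), g (S z.1, z.2))] =
      mu [set w | W ((S w, E w), U w)].
Proof.
have /choice[G GP] : forall r : R, exists G : TS -> R,
    [/\ measurable_fun setT G, forall s, (0 <= G s <= 1)%R
      & forall W : set (TS * TE), measurable W ->
        mu (U @^-1` `]-oo, r[ `&` SE @^-1` W) =
        \int[mu]_(w in SE @^-1` W) (G (S w))%:E].
  by move=> r; apply: UES; exact: measurable_itv.
have mG r : measurable_fun setT (G r) by case: (GP r).
have mGS r : measurable_fun setT (G r \o S) by exact: measurableT_comp.
have mU r : measurable (U @^-1` `]-oo, r[) by apply: measurable_funPTI; exact: measurable_itv.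
pose fib (A : set Omega) r := fst @^-1` A `&` below (G r \o S).
have mfib A r : measurable A -> measurable (fib A r).
  move=> mA; apply: measurableI; last exact: measurable_below.
  exact: measurable_preimage.
have Mlty X : measurable X -> M X < +oo.
  by move=> mX; apply: le_lt_trans (ltry 1); exact: (@probability_le1 _ _ _ (mu \x unif R)).
have Mfib W r : measurable W ->
    M (fib (SE @^-1` W) r) = mu (U @^-1` `]-oo, r[ `&` SE @^-1` W).
  move=> mW; case: (GP r) => _ G01 ->//.
  by rewrite -(product_below mu (measurable_preimage mSE mW) (mGS r) (fun x => G01 (S x))).
(* Almost sure monotonicity of [G]: on the part [W'] of [W] where [G r < G q], the larger region
   [fib q] has by [Mfib] at most the mass of [fib r], so the difference is null. *)
have fib0 W q r : measurable W -> (q <= r)%R ->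
    M (fib (SE @^-1` W) q `\` fib (SE @^-1` W) r) = 0.
  move=> mW qr.
  pose W' := W `&` (fst @^-1` [set s | (G r s < G q s)%R]).
  have mW' : measurable W'.
    apply: measurableI => //; apply: measurable_preimage => //.
    rewrite (_ : mkset _ = (fun s => (G r s < G q s)%R) @^-1` [set true]).
      by apply: measurable_preimage => //; exact: measurable_fun_ltr.
    by apply/seteqP; split.
  have mA' : measurable (SE @^-1` W') by exact: measurable_preimage.
  rewrite (_ : _ `\` _ = fib (SE @^-1` W') q `\` fib (SE @^-1` W') r); last first.
    apply/seteqP; split => z /= [[Wz zq] nr].
      have Grq : (G r (S z.1) < G q (S z.1))%R.
        apply: le_lt_trans zq; rewrite leNgt; apply/negP => zr; exact: nr.
      by split; [split => //; split|move=> [[? _] zr]; apply: nr; split].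
    case: Wz => Wz Grq; split; first by split.
    by move=> [_ zr]; apply: nr; split.
  have le_fib : M (fib (SE @^-1` W') q) <= M (fib (SE @^-1` W') r).
    rewrite !Mfib//; apply: le_measure; rewrite ?inE; [exact: measurableI..|].
    apply: setSI => w /=; rewrite !in_itv/= => Uq; exact: lt_le_trans Uq qr.
  apply/eqP; rewrite eq_le measure_ge0 andbT measureD; [|exact: mfib..|by apply: Mlty; exact: mfib].
  rewrite setIidr ?sube_le0// => z [[Wz Grq] zr]; split; first by split.
  exact: lt_trans zr Grq.
have eq_ray W r : measurable W ->
    M [set z | W (SE z.1) /\ (quantile G (S z.1, z.2) < r)%R] =
    mu (U @^-1` `]-oo, r[ `&` SE @^-1` W).
  move=> mW; have mA : measurable (SE @^-1` W) by exact: measurable_preimage.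
  have [r1|r1] := leP r 1%R; last first.
    rewrite (_ : [set z | _] = SE @^-1` W `*` setT); last first.
      apply/seteqP; split => z /=; first by case.
      by move=> [Wz _]; split => //; exact: le_lt_trans (quantile_le1 _ _) r1.
    rewrite /M/= product_measure1E//= probability_setT mule1; congr (mu _).
    apply/seteqP; split => w /=; last by case.
    by move=> Ww; split => //=; rewrite in_itv/= (le_lt_trans _ r1)//; case/andP: (U01 w).
  pose cond n := (0 <= rational n <= 1)%R /\ (rational n < r)%R.
  pose A := SE @^-1` W.
  have mD n : measurable [set z : Omega * R | cond n /\ fib A (rational n) z].
    have [c|c] := pselect (cond n).
      rewrite (_ : mkset _ = fib A (rational n)); first exact: mfib.
      by apply/seteqP; split => z // [].
    rewrite (_ : mkset _ = set0)//.
    by apply/seteqP; split => z // [].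
  (* The event that the quantile is below [r], as a countable union over the rational levels below
     [r]. *)
  pose X := \bigcup_n [set z : Omega * R | cond n /\ fib A (rational n) z].
  have mX : measurable X by exact: bigcupT_measurable.
  rewrite (_ : [set z | _] = X); last first.
    apply/seteqP; split => z /=.
      by move=> [Wz] /(quantile_lt _ _ r1)[n [n01 nr zn]]; exists n.
    move=> [n _ [[n01 nr] [Wz zn]]]; split => //.
    by apply/(quantile_lt _ _ r1); exists n.
  (* Upper bound: each region in the union lies in [fib A r] up to a null set, by [fib0]. *)
  apply/eqP; rewrite eq_le; apply/andP; split.
    rewrite -(Mfib _ _ mW).
    have XD0 : M (X `\` fib A r) = 0.
      apply/negligibleP; first by apply: measurableD => //; exact: mfib.
      rewrite /X setD_bigcupl; apply: negligible_bigcup => n.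
      apply/negligibleP; first by apply: measurableD => //; exact: mfib.
      have [c|c] := pselect (cond n); last first.
        rewrite (_ : _ `\` _ = set0) ?measure0//.
        by apply/seteqP; split => z // [[]].
      rewrite (_ : mkset _ = fib A (rational n)); last first.
        by apply/seteqP; split => z // [].
      by apply: fib0 => //; case: c => _ /ltW.
    have -> : M X = M (X `&` fib A r).
      by rewrite -[RHS]add0e -XD0; apply: measureDI => //; exact: mfib.
    apply: le_measure; rewrite ?inE; [|exact: mfib|by move=> ? []].
    by apply: measurableI => //; exact: mfib.
  (* Lower bound: the event [U < r] is the increasing limit of [F n], and [F n] involves finitely
     many levels, so the largest of them bounds its mass by that of a single region inside [X]. *)
  pose F n := [set w | A w /\ exists i, [/\ (i < n)%N, cond i & (U w < rational i)%R]].
  have FS n : F n = set0 \/ exists2 i, cond i & F n `<=` U @^-1` `]-oo, rational i[ `&` A.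
    elim: n => [|n [IH|[i ci IH]]].
    - by left; apply/seteqP; split => w // [_ [? []]].
    - have [c|c] := pselect (cond n).
        right; exists n => // w [Aw [j [jn cj Uj]]]; split => //=; rewrite in_itv/=.
        move: jn; rewrite ltnS leq_eqVlt => /predU1P[<-//|jn].
        have : F n w by split => //; exists j.
        by rewrite IH.
      left; apply/seteqP; split => w // [Aw [j [jn cj Uj]]].
      move: jn; rewrite ltnS leq_eqVlt => /predU1P[jn|jn]; first by rewrite -jn in c.
      by rewrite -IH; split => //; exists j.
    - right; have [[c ni]|c] := pselect (cond n /\ (rational i < rational n)%R).
        exists n => // w [Aw [j [jn cj Uj]]]; split => //=; rewrite in_itv/=.
        move: jn; rewrite ltnS leq_eqVlt => /predU1P[<-//|jn].
        apply: lt_trans ni; have /IH[+ _] : F n w by split => //; exists j.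
        by rewrite /= in_itv.
      exists i => // w [Aw [j [jn cj Uj]]].
      move: jn; rewrite ltnS leq_eqVlt => /predU1P[jn|jn]; last first.
        by apply: IH; split => //; exists j.
      split => //=; rewrite in_itv/=; apply: lt_le_trans Uj _.
      by rewrite leNgt; apply/negP => ij; apply: c; rewrite -jn.
  have mF n : measurable (F n).
    rewrite (_ : F n = \bigcup_i [set w | A w /\ ((i < n)%N /\ cond i) /\ (U w < rational i)%R]).
      apply: bigcupT_measurable => i.
      have [c|c] := pselect ((i < n)%N /\ cond i); last first.
        by rewrite (_ : mkset _ = set0)//; apply/seteqP; split => w // [_ []].
      rewrite (_ : mkset _ = A `&` U @^-1` `]-oo, rational i[); first exact: measurableI.
      by apply/seteqP; split => w /=; rewrite in_itv/=; tauto.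
    apply/seteqP; split => w; first by move=> [Aw [i [? ? ?]]]; exists i.
    by move=> [i _ [Aw [[? ?] ?]]]; split => //; exists i.
  have FU : U @^-1` `]-oo, r[ `&` A = \bigcup_n F n.
    apply/seteqP; split => w.
      move=> [/=]; rewrite in_itv/= => Ur Aw.
      have [i /andP[Ui ir]] := rational_dense Ur.
      exists i.+1 => //; split => //; exists i; split => //; split => //.
      rewrite (le_trans (ltW ir) r1) andbT; apply: le_trans (ltW Ui).
      by case/andP: (U01 w).
    move=> [n _ [Aw [i [_ [_ ir] Ui]]]]; split => //=; rewrite in_itv/=.
    exact: lt_trans Ui ir.
  have ndF : {homo F : n m / (n <= m)%N >-> (n <= m)%O}.
    move=> n m nm; apply/subsetPset => w [Aw [i [ni ? ?]]]; split => //.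
    by exists i; split => //; exact: leq_trans nm.
  rewrite -/A FU.
  have mFF : measurable (\bigcup_n F n) by exact: bigcupT_measurable.
  have cF := nondecreasing_cvg_mu (mu := mu) mF mFF ndF.
  rewrite -(cvg_lim _ cF)//; apply: lime_le; first by apply/cvg_ex; eexists; exact: cF.
  apply: nearW => n /=; have [->|[i ci Fi]] := FS n; first by rewrite measure0 measure_ge0.
  apply: (@le_trans _ _ (mu (U @^-1` `]-oo, rational i[ `&` A))).
    by apply: le_measure; rewrite ?inE//; exact: measurableI.
  rewrite -(Mfib _ _ mW); apply: le_measure; rewrite ?inE//; first exact: mfib.
  by move=> z fz; exists i.
exists (quantile G); split; first exact: measurable_quantile.
have mq : measurable_fun setT (fun z : Omega * R => quantile G (S z.1, z.2)).
  apply: (measurableT_comp (measurable_quantile mG)).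
  by apply: measurable_fun_pair => //; exact: measurableT_comp.
pose Q := mfun_of mq.
have mSEQ : measurable_fun setT (fun z : Omega * R => (SE z.1, Q z)).
  by apply: measurable_fun_pair => //; exact: measurableT_comp.
have mSEU : measurable_fun setT (fun w => (SE w, U w)).
  exact: measurable_fun_pair.
move=> X mX.
pose m1 := image_measure M (mfun_of mSEQ).
pose m2 := image_measure mu (mfun_of mSEU).
rewrite -[LHS]/(m1 X) -[RHS]/(m2 X).
apply: measure_unique_rect mX => [|W B mW].
  by rewrite /m1 image_measureE preimage_setT; exact: Mlty.
have mA : measurable (SE @^-1` W) by exact: measurable_preimage.
have mA' : measurable ((SE \o @fst Omega R) @^-1` W).
  by apply: measurable_preimage => //; exact: measurableT_comp.
pose n1 := image_measure (mrestr M mA') Q.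
pose n2 := image_measure (mrestr mu mA) U.
rewrite (_ : m1 _ = n1 B); last by congr (M _); apply/seteqP; split => z /=; tauto.
rewrite (_ : m2 _ = n2 B); last by congr (mu _); apply/seteqP; split => z /=; tauto.
move: B; apply: measure_unique_ray.
- exact: (Mlty _ (measurableI _ _ measurableT mA')).
- rewrite (_ : n1 _ = M (SE @^-1` W `*` setT)); last first.
    by congr (M _); apply/seteqP; split => z /=; tauto.
  rewrite (_ : n2 _ = mu (SE @^-1` W)); last first.
    by congr (mu _); apply/seteqP; split => z /=; tauto.
  by rewrite /M/= product_measure1E//= probability_setT mule1.
- move=> r.
  transitivity (M [set z | W (SE z.1) /\ (quantile G (S z.1, z.2) < r)%R]).
    by congr (M _); apply/seteqP; split => z /=; rewrite in_itv/=; tauto.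
  exact: eq_ray.
Qed.
End Resampling.

(** * Coding noise by real numbers *)

Section TernaryCode.
Variable R : realType.

(** Partial sums of a Cantor set point with ternary digits 0 and 2. As the digit 1 never occurs, the
    leading digit is read off by comparison with 1/2, and [code_tail] strips digits one at a
    time. *)
Fixpoint partial_code (n : nat) (s : nat -> bool) : R :=
  if n is m.+1 then (((s 0%N)%:R * 2 + partial_code m (fun k => s k.+1)) / 3)%R else 0%R.

Definition ternary_code s : R := sup (range (partial_code ^~ s)).

Fixpoint code_tail (n : nat) (y : R) : R :=
  if n is m.+1 then code_tail m (y * 3 - (2^-1 <= y)%R%:R * 2)%R else y.

Definition digit n y := (2^-1 <= code_tail n y)%R.

Let partial_code01 n s : (0 <= partial_code n s <= 1)%R.
Proof.
elim: n s => [|n IH] s /=; first by rewrite lexx ler01.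
by have /andP[? ?] := IH (fun k => s k.+1); case: (s 0%N) => /=; apply/andP; split; lra.
Qed.

Let partial_code_nd s : nondecreasing_seq (partial_code ^~ s).
Proof.
apply/nondecreasing_seqP => n.
elim: n s => [|n IH] s; first by have /andP[] := partial_code01 1 s.
by have := IH (fun k => s k.+1); rewrite /= => ?; lra.
Qed.

Lemma ternary_code_cvg s : partial_code ^~ s @ \oo --> ternary_code s.
Proof.
apply: nondecreasing_cvgn => //; exists 1%R => _ [n _ <-].
by have /andP[] := partial_code01 n s.
Qed.

Lemma ternary_code01 s : (0 <= ternary_code s <= 1)%R.
Proof.
rewrite -(cvg_lim _ (@ternary_code_cvg s))//; apply/andP; split.
  apply: limr_ge; first by apply/cvg_ex; eexists; exact: ternary_code_cvg.
  by apply: nearW => n; have /andP[] := partial_code01 n s.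
apply: limr_le; first by apply/cvg_ex; eexists; exact: ternary_code_cvg.
by apply: nearW => n; have /andP[] := partial_code01 n s.
Qed.

Lemma ternary_codeE s : ternary_code s = (((s 0%N)%:R * 2 + ternary_code (fun k => s k.+1)) / 3)%R.
Proof.
have h1 := @ternary_code_cvg s; rewrite -cvg_shiftS in h1.
apply: (cvg_unique _ h1) => //=.
apply: cvgMl; apply: cvgD; [exact: cvg_cst|exact: ternary_code_cvg].
Qed.

Lemma digit_ternary_code n s : digit n (ternary_code s) = s n.
Proof.
have d0 u : (2^-1 <= ternary_code u)%R = u 0%N.
  rewrite ternary_codeE; have /andP[? ?] := ternary_code01 (fun k => u k.+1).
  by case: (u 0%N) => /=; [apply/idP|apply/negbTE; rewrite -ltNge]; lra.
rewrite /digit; elim: n s => [|n IH] s /=; first exact: d0.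
rewrite d0 -(IH (fun k => s k.+1)); congr (_ <= code_tail n _)%R.
by rewrite ternary_codeE; lra.
Qed.

Lemma measurable_ternary_code d (T : measurableType d) (b : T -> nat -> bool) :
  (forall n, measurable_fun setT (b ^~ n)) -> measurable_fun setT (fun x => ternary_code (b x)).
Proof.
move=> mb; apply: (measurable_fun_cvg (h := fun n x => partial_code n (b x))).
  move=> n; elim: n b mb => [|n IH] b mb /=; first exact: measurable_cst.
  apply: measurable_funM; last exact: measurable_cst.
  apply: measurable_funD; last exact: (IH (fun x k => b x k.+1)).
  apply: measurable_funM; last exact: measurable_cst.
  rewrite (_ : (fun x => _) = (fun x => if b x 0%N then 1%R else 0%R)).
    by apply: measurable_fun_ifT => //; exact: measurable_cst.
  by apply/funext => x; case: (b x 0%N).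
by move=> x _; exact: ternary_code_cvg.
Qed.

Lemma measurable_digit n : measurable_fun setT (digit n).
Proof.
apply: measurable_fun_ler; first exact: measurable_cst.
(* The recursion of [code_tail] changes its argument, so the induction must allow an arbitrary inner
   function. *)
suff h (f : R -> R) : measurable_fun setT f -> measurable_fun setT (code_tail n \o f).
  exact: h (@measurable_id _ _ _).
elim: n f => [|n IH] f mf //=.
apply: (IH (fun y => f y * 3 - (2^-1 <= f y)%R%:R * 2)%R).
apply: measurable_funB; first by apply: measurable_funM => //; exact: measurable_cst.
apply: measurable_funM; last exact: measurable_cst.
rewrite (_ : (fun x => _) = (fun x => if (2^-1 <= f x)%R then 1%R else 0%R)).
  by apply: measurable_fun_ifT => //; exact: measurable_fun_ler.
by apply/funext => x; case: (2^-1 <= f x)%R.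
Qed.

End TernaryCode.

Section ProductSpace.
Context (I : Type) (X : I -> state_space).

Lemma measurable_coordinate i :
  measurable_fun setT (fun x : product_space X => x i : X i).
Proof.
move=> _ A mA; rewrite setTI; apply: sub_sigma_algebra; exists i => //.
by exists A => //; rewrite setTI.
Qed.

Lemma measurable_to_product d (T : measurableType d) (h : T -> product_space X) :
  (forall i, measurable_fun setT (fun t => h t i : X i)) -> measurable_fun setT h.
Proof.
move=> mh; apply: (@measurability _ _ T (product_space X) setT h (@product_sets I X)) => //.
move=> _ [_ [i _ [A mA <-]] <-]; rewrite !setTI.
exact: (measurable_preimage (mh i) mA).
Qed.

End ProductSpace.

Definition real_space (R : realType) : state_space := StateSpace R.

Definition noise (R : realType) (I : Type) := product_space (fun _ : I => real_space R).

Section Encoding.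
Context (R : realType) (I : countType).

(** Each coordinate is recorded by its cut in the rationals; the bits over all pairs of an index and
    a rational form one binary sequence. *)
Let below_rational (x : noise R I) (n : nat) : bool :=
  if unpickle n is Some (i, q) then (ratr q < (x : I -> R) i)%R else false.

Let encode (x : noise R I) : R := @ternary_code R (below_rational x).

(** The value [-oo] is neutral in the supremum by which [decode] recovers coordinate [i] from its
    cut. *)
Let term (y : R) (i : I) (n : nat) : \bar R :=
  if unpickle n is Some (j, q) then
    if (j == i) && digit n y then (ratr q)%:E else -oo
  else -oo.

Let decode (y : R) : noise R I := fun i => fine (esups (term y i) 0%N).

Let measurable_encode : measurable_fun setT encode.
Proof.
apply: measurable_ternary_code => n; rewrite /below_rational.
case: (unpickle n) => [[i q]|]; last exact: measurable_cst.
apply: measurable_fun_ltr; first exact: measurable_cst.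
exact: (@measurable_coordinate _ (fun=> real_space R)).
Qed.

Let measurable_decode : measurable_fun setT decode.
Proof.
apply: measurable_to_product => i.
apply: (measurableT_comp (@fine_measurable R setT measurableT)).
apply: (@measurable_fun_esups _ _ _ setT (fun n y => term y i n)) => n.
rewrite /term; case: (unpickle n) => [[j q]|]; last exact: measurable_cst.
case: (j == i) => /=; last exact: measurable_cst.
by apply: measurable_fun_ifT => //; exact: measurable_digit.
Qed.

Let decodeK : cancel encode decode.
Proof.
move=> x; apply/funext => i; rewrite /decode.
suff -> : esups (term (encode x) i) 0%N = ((x : I -> R) i)%:E by [].
have termE n : term (encode x) i n =
    if unpickle n is Some (j, q) then
      if (j == i) && (ratr q < (x : I -> R) j)%R then (ratr q)%:E else -oo else -oo.
  by rewrite /term /encode digit_ternary_code /below_rational; case: (unpickle n) => [[]|].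
apply/eqP; rewrite eq_le; apply/andP; split.
  apply: ge_ereal_sup => _ [n _ <-]; rewrite termE.
  case: (unpickle n) => [[j q]|]; last exact: leNye.
  case: eqP => [->|] /=; last by rewrite leNye.
  by case: ifPn; rewrite ?leNye// lee_fin => /ltW.
apply/lee_addgt0Pr => e e0.
have [q] : exists q, ratr q \in `](x : I -> R) i - e, (x : I -> R) i[%R.
  by apply: rat_in_itvoo; rewrite ltrBlDr ltrDl.
rewrite in_itv/= => /andP[xq qx].
apply: (@le_trans _ _ ((ratr q)%:E + e%:E)).
  by rewrite -EFinD lee_fin -lerBlDr ltW.
rewrite leeD2r//; apply: ereal_sup_ubound; exists (pickle (i, q)) => //.
by rewrite termE pickleK eqxx qx.
Qed.

(** Lets a whole family of noise be redrawn as one real variable, and makes every probability on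
    [noise R I] standard. *)
Lemma noise_encoding : exists (enc : noise R I -> R) (dec : R -> noise R I),
  [/\ measurable_fun setT enc, measurable_fun setT dec,
      forall x, (0 <= enc x <= 1)%R & cancel enc dec].
Proof.
exists encode, decode; split => // x; exact: ternary_code01.
Qed.

End Encoding.

Section Standard.
Context (R : realType).

Lemma standard_probability_ext d (T : measurableType d) (mu nu : probability T R) :
  (forall A, measurable A -> mu A = nu A) ->
  standard_probability mu -> standard_probability nu.
Proof.
move=> munu [A [phi [mA muA mphi iphi ophi]]].
by exists A, phi; split => //; rewrite -munu.
Qed.

Lemma standard_probability_coding d (T : measurableType d) (mu : probability T R)
    (A : set T) (phi : T -> R) (g : R -> T) :
  measurable A -> mu A = 1 -> measurable_fun setT phi -> measurable_fun setT g ->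
  (forall t, A t -> g (phi t) = t) -> standard_probability mu.
Proof.
move=> mA muA mphi mg gK; exists A, phi; split => //.
- exact: measurable_funTS.
- by move=> t u /set_mem At /set_mem Au tu; rewrite -(gK t)// tu gK.
- move=> S mS SA.
  rewrite (_ : _ @` _ = g @^-1` S `&` [set y | phi (g y) == y]).
    apply: measurableI; first exact: measurable_preimage.
    rewrite (_ : mkset _ = (fun y => phi (g y) == y) @^-1` [set true]).
      apply: measurable_preimage => //; apply: measurable_fun_eqr => //.
      exact: measurableT_comp.
    by apply/seteqP; split.
  apply/seteqP; split => y /=; first by move=> [t St <-]; rewrite gK ?eqxx//; exact: SA.
  by move=> [Sgy /eqP gy]; exists (g y).
Qed.

Lemma probability_inhabited d (T : measurableType d) (mu : probability T R) (A : set T) :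
  mu A = 1 -> exists t, A t.
Proof.
move=> muA; apply/set0P/eqP => A0; move/eqP: muA.
by rewrite A0 measure0 eq_sym onee_eq0.
Qed.

(** The converse: measurability of images under [phi] is measurability of its inverse. Points
    outside the image of [A] are sent to a fixed [t0], and [phi] is made 0 outside [A], so both maps
    are total. *)
Lemma standard_probability_code d (T : measurableType d) (mu : probability T R) :
  standard_probability mu -> exists (A : set T) (phi : T -> R) (g : R -> T),
    [/\ measurable A, mu A = 1, measurable_fun setT phi, measurable_fun setT g
      & forall t, A t -> g (phi t) = t].
Proof.
move=> [A [phi [mA muA mphi iphi ophi]]].
have [t0 At0] := probability_inhabited muA.
pose g y := xget t0 [set t | A t /\ phi t = y].
have gK t : A t -> g (phi t) = t.
  move=> At; rewrite /g; case: xgetP => [u _ [Au ut]|/(_ t)]; last by case.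
  by apply: iphi => //; exact: mem_set.
exists A, (phi \_ A), g; split => //.
- by apply/(measurable_restrictT phi mA).
- move=> _ S mS; rewrite setTI.
  have gS : g @^-1` S = phi @` (A `&` S) `|` (~` (phi @` A) `&` [set y | S t0]).
    apply/seteqP; split => y /=.
      have [Ay|nAy] := pselect ((phi @` A) y).
        by case: Ay => t At <-; rewrite gK// => St; left; exists t.
      rewrite /g; case: xgetP => [u _ [Au uy] _|_ St0]; last by right.
      by exfalso; apply: nAy; exists u.
    move=> [[t [At St] <-]|[nAy St0]]; first by rewrite gK.
    rewrite /g; case: xgetP => // u _ [Au uy].
    by exfalso; apply: nAy; exists u.
  rewrite gS; apply: measurableU; first by apply: ophi; [exact: measurableI|by move=> ? []].
  have [St0|nSt0] := pselect (S t0).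
    rewrite (_ : [set y | S t0] = setT) ?setIT; last by apply/seteqP; split.
    by apply: measurableC; exact: ophi.
  by rewrite (_ : [set y | S t0] = set0) ?setI0//; apply/seteqP; split.
- by move=> t At; rewrite patchE mem_set// gK.
Qed.

Lemma standard_probability_noise (I : countType) (mu : probability (noise R I) R) :
  standard_probability mu.
Proof.
have [enc [dec [menc mdec _ encK]]] := noise_encoding R I.
apply: (standard_probability_coding measurableT _ menc mdec) => //.
exact: probability_setT.
Qed.

Definition product_probability d (T : measurableType d) (mu : probability T R) :
    probability (T * R)%type R := mu \x unif R.

Lemma standard_probability_product d (T : measurableType d) (mu : probability T R) :
  standard_probability mu -> standard_probability (product_probability mu).
Proof.
move=> /standard_probability_code[A [phi [g [mA muA mphi mg gK]]]].
have [enc [dec [menc mdec _ encK]]] := noise_encoding R bool.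
pose pair (z : T * R) : noise R bool := fun b => if b then phi z.1 else z.2.
have mpair : measurable_fun setT pair.
  apply: measurable_to_product => -[] /=; last exact: measurable_snd.
  exact: (measurableT_comp mphi).
pose unpair y : T * R := (g (dec y true), dec y false).
have munpair : measurable_fun setT unpair.
  have mcoord b : measurable_fun setT (fun y => dec y b : real_space R).
    exact: (measurableT_comp (@measurable_coordinate _ (fun=> real_space R) b) mdec).
  apply: measurable_fun_pair; last exact: mcoord.
  exact: (measurableT_comp mg (mcoord true)).
apply: (@standard_probability_coding _ _ _ (A `*` setT) (enc \o pair) unpair) => //.
- exact: measurableX.
- transitivity (mu A * unif R setT); last by rewrite muA mul1e probability_setT.
  exact: product_measure1E.
- exact: measurableT_comp.
- by move=> [t x] [/= At _]; rewrite /unpair encK /pair /= gK.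
Qed.

End Standard.

Lemma measurable_box (I : finType) (X : I -> state_space) (A : forall i, set (X i)) :
  (forall i, measurable (A i)) ->
  measurable [set x : product_space X | forall i, A i (x i)].
Proof.
move=> mA; rewrite (_ : mkset _ =
  \bigcap_(i in [set: I]) ((fun x : product_space X => x i : X i) @^-1` A i)).
  apply: fin_bigcap_measurable; first exact: finite_finset.
  by move=> i _; apply: measurable_preimage => //; exact: measurable_coordinate.
by apply/seteqP; split => x /= xA => [i _|i]; exact: xA.
Qed.

Lemma measure_unique_product (R : realType) (I : finType) (X : I -> state_space)
    (m1 m2 : {measure set (product_space X) -> \bar R}) :
  m1 setT < +oo ->
  (forall A : forall i, set (X i), (forall i, measurable (A i)) ->
    m1 [set x | forall i, A i (x i)] = m2 [set x | forall i, A i (x i)]) ->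
  forall S, measurable S -> m1 S = m2 S.
Proof.
move=> m1oo m12.
pose box (A : forall i, set (X i)) : set (product_space X) := [set x | forall i, A i (x i)].
pose G : set (set (product_space X)) := [set box A | A in [set A | forall i, measurable (A i)]].
apply: (@measure_unique_pi _ (product_space X) R G) => //.
- apply/seteqP; split.
    apply: smallest_sub; first exact: smallest_sigma_algebra.
    move=> _ [i _ [A mA <-]]; apply: sub_sigma_algebra.
    exists (dfwith (fun j => setT) i A).
      by move=> j; case: dfwithP.
    rewrite setTI; apply/seteqP; split => x.
      by move=> /(_ i); rewrite dfwithin.
    by move=> xA j; case: dfwithP.
  apply: smallest_sub; first exact: sigma_algebra_measurable.
  by move=> _ [A mA <-]; exact: measurable_box.
- move=> _ _ [A mA <-] [B mB <-]; exists (fun i => A i `&` B i).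
    by move=> i; exact: measurableI.
  by apply/seteqP; split => x /=; [move=> AB; split=> i; case: (AB i)|move=> [? ?] i; split].
- by exists (fun=> setT) => //; apply/seteqP; split.
- by move=> _ [A mA <-]; exact: m12.
Qed.

(** * Independence of disjoint subfamilies of noise *)

Section Mask.
Context (R : realType) (I : finType).

(** Hidden coordinates are set to 0 rather than dropped, so that all subfamilies share one type. *)
Definition mask_noise (K : pred I) (n : noise R I) : noise R I :=
  fun i => if K i then n i else 0%R.

Lemma measurable_mask_noise K : measurable_fun setT (mask_noise K).
Proof.
apply: measurable_to_product => i; rewrite /mask_noise; case: (K i) => //.
exact: (@measurable_coordinate _ (fun=> real_space R)).
Qed.

Lemma mask_noiseK K K' (n : noise R I) : {subset K <= K'} ->
  mask_noise K (mask_noise K' n) = mask_noise K n.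
Proof.
move=> KK'; apply/funext => i; rewrite /mask_noise; case: ifP => // Ki.
by have -> : K' i by exact: KK'.
Qed.

Context d (Omega : measurableType d) (mu : probability Omega R)
  (eta : forall i : I, {mfun Omega >-> real_space R}).

Definition observe (w : Omega) : noise R I := fun i => eta i w.

Lemma measurable_observe : measurable_fun setT observe.
Proof. by apply: measurable_to_product => i; exact: measurable_funPT. Qed.

Lemma measurable_mask_observe K : measurable_fun setT (mask_noise K \o observe).
Proof. exact: measurableT_comp (measurable_mask_noise K) measurable_observe. Qed.

Definition masked K : {mfun Omega >-> noise R I} := mfun_of (measurable_mask_observe K).

Hypothesis eta_indep : independent mu eta.

Let masked_box K (A : I -> set R) : (forall i, ~~ K i -> A i 0%R) ->
  masked K @^-1` [set x : noise R I | forall i, A i (x i)] =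
  \bigcap_(i in [set` [set i | K i]%SET]) (eta i @^-1` A i).
Proof.
move=> A0; apply/seteqP; split => w /= Aw i.
  by move=> Ki; have := Aw i; rewrite /mask_noise; move: Ki; rewrite /= inE => ->.
rewrite /mask_noise; case: ifP => [Ki|/negbT/A0//].
by apply: (Aw i); rewrite /= inE.
Qed.

Let masked_box0 K (A : I -> set R) : ~ (forall i, ~~ K i -> A i 0%R) ->
  masked K @^-1` [set x : noise R I | forall i, A i (x i)] = set0.
Proof.
move=> A0; apply/seteqP; split => w //= Aw; apply: A0 => i Ki.
by have := Aw i; rewrite /mask_noise (negbTE Ki).
Qed.

Lemma masked_independent2 (K1 K2 : pred I) (A1 A2 : set (noise R I)) :
  (forall i, ~~ (K1 i && K2 i)) -> measurable A1 -> measurable A2 ->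
  mu (masked K1 @^-1` A1 `&` masked K2 @^-1` A2) =
  mu (masked K1 @^-1` A1) * mu (masked K2 @^-1` A2).
Proof.
move=> K12.
have mM K A : measurable A -> measurable (masked K @^-1` A) by exact: measurable_funPTI.
(* For a fixed event [A], both sides are finite measures of [B], so boxes suffice. This is used once
   for each of the two arguments. *)
have extend K (A : set Omega) (mA : measurable A) :
    (forall B : I -> set R, (forall i, measurable (B i)) ->
      mu (masked K @^-1` [set x : noise R I | forall i, B i (x i)] `&` A) =
      mu (masked K @^-1` [set x : noise R I | forall i, B i (x i)]) * mu A) ->
    forall B, measurable B -> mu (masked K @^-1` B `&` A) = mu (masked K @^-1` B) * mu A.
  move=> HB B mB.
  have fA : mu A \is a fin_num by exact: fin_num_measure.
  pose p : {nonneg R} := NngNum (fine_ge0 (measure_ge0 mu A)).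
  pose m1 := image_measure (mrestr mu mA) (masked K).
  pose m2 := image_measure (mscale p mu) (masked K).
  have m2E S : m2 S = mu (masked K @^-1` S) * mu A.
    by rewrite muleC -[in RHS](fineK fA).
  rewrite -m2E; apply: (@measure_unique_product _ _ (fun=> real_space R) m1 m2) => //.
    apply: le_lt_trans (ltry 1).
    exact: (probability_le1 mu (measurableI _ _ measurableT mA)).
  by move=> B' mB'; rewrite m2E; exact: HB.
move=> mA1 mA2; apply: (extend K1 _ (mM _ _ mA2) _ _ mA1) => B1 mB1.
have mbox1 := mM K1 _ (@measurable_box _ (fun=> real_space R) _ mB1).
rewrite setIC muleC; apply: (extend K2 _ mbox1 _ _ mA2) => B2 mB2.
have [c1|c1] := pselect (forall i, ~~ K1 i -> B1 i 0%R); last first.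
  by rewrite (masked_box0 c1) setI0 measure0 mule0.
have [c2|c2] := pselect (forall i, ~~ K2 i -> B2 i 0%R); last first.
  by rewrite (masked_box0 c2) set0I measure0 mul0e.
rewrite (masked_box c1) (masked_box c2) !eta_indep//.
pose B i := if K1 i then B1 i else B2 i.
have mB i : measurable (B i) by rewrite /B; case: ifP.
rewrite (_ : _ `&` _ = \bigcap_(i in [set` [set i | K1 i || K2 i]%SET]) (eta i @^-1` B i)).
  rewrite eta_indep// (bigID [pred i | K2 i])/=; congr (_ * _).
    apply: eq_big => i; rewrite !inE; first by case: (K1 i); case: (K2 i).
    by move=> /andP[_ K2i]; rewrite /B; have := K12 i; rewrite K2i andbT => /negbTE ->.
  apply: eq_big => i; rewrite !inE.
    by have := K12 i; case: (K1 i); case: (K2 i).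
  by rewrite /B; case: (K1 i); case: (K2 i).
apply/seteqP; split => w /=.
  move=> [h2 h1] i; rewrite /= inE /B; case: ifP => [K1i _|_ /= K2i].
    by apply: h1; rewrite /= inE.
  by apply: h2; rewrite /= inE.
move=> h; split => i; rewrite /= inE => Ki; have := h i; rewrite /= inE Ki /B ?orbT => /(_ isT).
  by have := K12 i; rewrite Ki andbT => /negbTE ->.
by rewrite Ki.
Qed.

Definition noise_space : state_space := StateSpace (noise R I).

Lemma masked_independent (W : finType) (K : W -> pred I) :
  (forall w w' i, K w i -> K w' i -> w = w') ->
  independent mu (Y := fun=> noise_space) (fun w => masked (K w)).
Proof.
move=> Kinj J A mA.
have [n] := ubnP #|J|; elim: n J => // n IH J; rewrite ltnS => Jn.
have [->|[w wJ]] := set_0Vmem J.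
  rewrite big_set0 (_ : \bigcap_(_ in _) _ = setT) ?probability_setT//.
  by apply/seteqP; split => x // _ w; rewrite /= inE.
rewrite (big_setD1 w wJ)/= -IH; last first.
  by rewrite (leq_trans _ Jn)// [X in (_ < X)%N](cardsD1 w) wJ.
(* All blocks of [J] other than [w] together are a function of the noise in [K'], which is disjoint
   from [K w]. *)
pose K' : pred I := fun i => [exists w' in (J :\ w)%SET, K w' i].
pose A' : set (noise R I) :=
  \bigcap_(w' in [set` (J :\ w)%SET]) (mask_noise (K w') @^-1` A w').
have mA' : measurable A'.
  apply: fin_bigcap_measurable; first exact: finite_finset.
  by move=> w' _; apply: measurable_preimage => //; exact: measurable_mask_noise.
have A'E : \bigcap_(w' in [set` (J :\ w)%SET]) (masked (K w') @^-1` A w') = masked K' @^-1` A'.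
  apply/seteqP; split => x /= h w' w'J; have := h w' w'J; rewrite /= mask_noiseK//.
    by move=> i Ki; apply/exists_inP; exists w'.
  by move=> i Ki; apply/exists_inP; exists w'.
rewrite A'E -masked_independent2//; last first.
  move=> i; apply/negP => /andP[Ki /exists_inP[w' w'J Ki']].
  by move: w'J; rewrite !inE (Kinj _ _ _ Ki' Ki) eqxx.
rewrite -A'E; congr (mu _); apply/seteqP; split => x /=.
  move=> h; split; first exact: (h w).
  by move=> w' /=; rewrite !inE => /andP[_ w'J]; exact: h.
move=> [hw h] w' w'J; have [->//|w'w] := eqVneq w' w.
by apply: h; rewrite /= !inE w'w.
Qed.

End Mask.

(** * Noise models *)

Section NoiseModel.
Context (R : realType) (V : finType) (X : V -> state_space).

(** Every function formally takes all values and all noise, its true arguments being a property;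
    changing the graph then changes no types. *)
Definition local_at (e : rel V) (I : finType) (S : I -> {set V}) (v : V)
    (f : product_space X * noise R I -> X v) : Prop :=
  forall (y y' : product_space X) (n n' : noise R I),
    (forall u, e u v -> y u = y' u) -> (forall i, v \in S i -> n i = n' i) ->
    f (y, n) = f (y', n').

(* The randomness of a noise model is a finite family of independent real
   variables [eta i], and [eta i] is seen exactly by the vertices of [S i]:
   exogenous errors have [S i] a singleton, latent variables have [S i] a facet. *)
Definition noise_model (e : rel V) (F : {set {set V}}) :
    set (probability (product_space X) R) :=
  [set P : probability (product_space X) R |
    exists (Omega : state_space) (mu : probability Omega R) (I : finType)
      (S : I -> {set V}) (eta : forall i : I, {mfun Omega >-> real_space R})
      (f : forall v, {mfun (product_space X * noise R I)%type >-> X v})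
      (x : forall v, {mfun Omega >-> X v}),
    [/\ standard_probability mu /\
        (forall v, standard_probability (distribution mu (x v))),
        independent mu eta,
        (forall i, S i = finset.set0 \/ S i \in F),
        (forall v, local_at e S (f v)) /\
        (forall v w, x v w = f v ((fun u => x u w) : product_space X, observe eta w))
      & forall A : set (product_space X), measurable A ->
          P A = mu [set w | A (fun v => x v w)]]].

End NoiseModel.

Section ExtendParents.
Context (W : finType) (D : dag W) (X : W -> state_space) (w : W) (d : forall u, X u).

Definition extend_parents (p : parent_space D X w) : product_space X :=
  fun u => match pselect (u \in parents D w) with
           | left h => p (exist _ u h)
           | right _ => d u
           end.

Lemma extend_parentsE (x : forall u, X u) u : u \in parents D w ->
  extend_parents (fun v => x (val v)) u = x u.
Proof. by rewrite /extend_parents; case: pselect. Qed.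

Lemma measurable_extend_parents : measurable_fun setT extend_parents.
Proof.
apply: measurable_to_product => u; rewrite /extend_parents.
case: pselect => [h|_]; last exact: measurable_cst.
exact: (@measurable_coordinate _
  (fun v : {v : W | v \in parents D w} => X (val v)) (exist _ u h)).
Qed.

End ExtendParents.

Section NormalForm.
Context (R : realType) (V : finType) (G : mdag V) (X : V -> state_space).

(** Each [eta i] is assigned to one node of the canonical DAG, and the error of a node is the bundle
    of noise assigned to it. A latent variable equals its error, so its children read the bundle
    from it. *)
Lemma noise_to_marginal P :
  @noise_model R V X G (faces G) P -> marginal_model R G X P.
Proof.
move=> [Om [mu [I [S [eta [f [x [[stmu stx] etai SF [floc xE] PE]]]]]]]].
pose N := noise_space R I.
pose D := canonical_dag G.
have [w0 _] := probability_inhabited (probability_setT mu).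
pose placed i (o : option (V + latent G)) : Prop :=
  match o with
  | None => S i = finset.set0
  | Some (inl v) => S i \subset [set v]%SET
  | Some (inr A) => S i \subset val A
  end.
have /choice[node nodeP] : forall i, exists o, placed i o.
  move=> i; case: (SF i) => [Si|Si]; first by exists None.
  have [A mxA SA] := maxset_exists Si.
  have [A1|A1] := ltnP 1 #|A|.
    have AF : A \in nontrivial_facets G by rewrite inE A1 andbT inE.
    by exists (Some (inr (exist _ A AF))).
  have [S0|[v vS]] := set_0Vmem (S i); first by exists None.
  exists (Some (inl v)) => /=; have -> : [set v]%SET = S i; last by [].
  apply/eqP; rewrite eqEcard finset.sub1set vS cards1.
  exact: leq_trans (subset_leq_card SA) A1.
pose K (w : V + latent G) : pred I := fun i => node i == Some w.
have Kinj w w' i : K w i -> K w' i -> w = w'.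
  by move=> /eqP Kw /eqP; rewrite Kw => -[].
pose E w := masked eta (K w).
pose Z (A : latent G) : state_space := N.
pose z (w : V + latent G) : {mfun Om >-> sum_family X Z w} :=
  match w with inl v => x v | inr A => E (inr A) end.
pose d u : sum_family X Z u := z u w0.
pose collect v (p : parent_space D (sum_family X Z) (inl v) * N) : noise R I :=
  fun i => match node i with
           | Some (inl _) => (p.2 : noise R I) i
           | Some (inr A) => (extend_parents d p.1 (inr A) : noise R I) i
           | None => 0%R
           end.
have mext v : measurable_fun setT (fun p : parent_space D (sum_family X Z) (inl v) * N =>
    extend_parents d p.1).
  exact: (measurableT_comp (measurable_extend_parents d)).
have mcollect v : measurable_fun setT (@collect v).
  apply: measurable_to_product => i; rewrite /collect.
  have mi : measurable_fun setT (fun n : noise R I => n i : real_space R).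
    exact: (@measurable_coordinate _ (fun=> real_space R)).
  case: (node i) => [[u|A]|]; last exact: measurable_cst.
    exact: (measurableT_comp mi measurable_snd).
  exact: (measurableT_comp mi
    (measurableT_comp (@measurable_coordinate _ (sum_family X Z) (inr A)) (mext v))).
have mleft v : measurable_fun setT (fun p : parent_space D (sum_family X Z) (inl v) * N =>
    (@margin_left _ _ X Z (extend_parents d p.1), @collect v p)).
  apply: measurable_fun_pair; last exact: mcollect.
  apply: measurable_to_product => u.
  exact: (measurableT_comp (@measurable_coordinate _ (sum_family X Z) (inl u)) (mext v)).
pose h (w : V + latent G) :
    {mfun (parent_space D (sum_family X Z) w * N)%type >-> sum_family X Z w} :=
  match w with
  | inl v => mfun_of (measurableT_comp (measurable_funPT (f v)) (mleft v))
  | inr A => mfun_of (@measurable_snd _ _ (parent_space D (sum_family X Z) (inr A)) N)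
  end.
have mz : measurable_fun setT (fun o => (fun u => z u o) : product_space (sum_family X Z)).
  by apply: measurable_to_product => u; exact: measurable_funPT.
exists Z, (distribution mu (mfun_of mz)); split; last by move=> A mA; rewrite PE.
exists Om, mu, (fun=> N), E, h, z; split => //.
- by split => // w; exact: standard_probability_noise.
- exact: masked_independent.
- move=> [v|A] o //=; rewrite xE /=; apply: floc => [u Guv|i vSi].
    by rewrite /margin_left (extend_parentsE d (fun u => z u o))// !inE.
  have := nodeP i; rewrite /collect /placed /observe.
  case ni: (node i) => [[u|A]|]; last by move=> S0; rewrite S0 inE in vSi.
    move=> /fintype.subsetP/(_ _ vSi); rewrite inE => /eqP vu.
    by rewrite /= /mask_noise /K ni vu eqxx.
  move=> /fintype.subsetP/(_ _ vSi) vA.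
  rewrite (extend_parentsE d (fun u => z u o)) ?inE//.
  by rewrite /= /mask_noise /K ni eqxx.
- by move=> [v|A] //=; exact: standard_probability_noise.
Qed.

(** The error of every node, latent or not, is coded as one real noise variable, and the equations
    of the latent nodes are substituted into those of their children. *)
Lemma marginal_to_noise P :
  marginal_model R G X P -> @noise_model R V X G (faces G) P.
Proof.
case=> Z [Q [dQ PE]].
case: dQ => Om [mu [Y [E [f [x [[stmu stE] Ei xE stx QE]]]]]].
pose D := canonical_dag G.
have code w := standard_probability_code (stE w).
pose A w := sval (cid (code w)).
have code1 w := svalP (cid (code w)).
pose phi w := sval (cid (code1 w)).
have code2 w := svalP (cid (code1 w)).
pose g w := sval (cid (code2 w)).
have gP w : [/\ measurable (A w), distribution mu (E w) (A w) = 1,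
    measurable_fun setT (phi w), measurable_fun setT (g w)
    & forall t, A w t -> g w (phi w t) = t] := svalP (cid (code2 w)).
pose O := \bigcap_(w in [set` [set: V + latent G]%SET]) (E w @^-1` A w).
have mA w : measurable (A w) by case: (gP w).
have mO : measurable O.
  apply: fin_bigcap_measurable; first exact: finite_finset.
  by move=> w _; exact: measurable_funPTI.
have muO : mu O = 1 by rewrite Ei// big1// => w _; case: (gP w).
have [t0 Ot0] := probability_inhabited muO.
(* [r] moves the null set outside [O] into [O], where the codes are faithful,
   so that the structural equations survive the recoding everywhere. *)
pose r o := if o \in O then o else t0.
have rO o : O (r o) by rewrite /r; case: ifPn => [/set_mem|].
have mr : measurable_fun setT r.
  apply: measurable_fun_ifT => //; apply: (measurable_fun_bool true).
  rewrite setTI (_ : _ @^-1` _ = O)//.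
  by apply/seteqP; split => o /=; [move/set_mem|move/mem_set].
have mur T : measurable T -> mu (r @^-1` T) = mu T.
  have mutO T' : measurable T' -> mu T' = mu (T' `&` O).
    move=> mT'; rewrite [LHS](measureDI mu mT' mO) [X in X + _](_ : _ = 0) ?add0e//.
    apply/eqP; rewrite eq_le measure_ge0 andbT.
    rewrite -[leRHS](_ : mu (~` O) = 0).
      apply: le_measure; rewrite ?inE; [exact: measurableD|exact: measurableC|].
      by move=> o [].
    by rewrite probability_setC// muO subee.
  move=> mT; rewrite mutO; last exact: measurable_preimage.
  rewrite (mutO T)//; congr (mu _); apply/seteqP.
  by split => o [/= To Oo]; split => //; move: To; rewrite /r mem_set.
(* A latent node has no parents, so this is the only element of its parent space. *)
pose p0 (B : latent G) : parent_space D (sum_family X Z) (inr B) :=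
  fun u => x (val u) t0.
pose full (yn : product_space X * noise R (V + latent G)%type) (u : V + latent G) :
    sum_family X Z u :=
  match u with
  | inl u => yn.1 u
  | inr B => f (inr B) (p0 B, g (inr B) (yn.2 (inr B)))
  end.
have mcoord w : measurable_fun setT
    (fun yn : product_space X * noise R (V + latent G)%type => g w (yn.2 w)).
  have mg : measurable_fun setT (g w) by case: (gP w).
  apply: (measurableT_comp mg).
  apply: (measurableT_comp (@measurable_coordinate _ (fun=> real_space R) w)).
  exact: measurable_snd.
have mfull u : measurable_fun setT (fun yn => full yn u).
  case: u => [u|B] /=.
    apply: (measurableT_comp (@measurable_coordinate _ X u)); exact: measurable_fst.
  apply: (measurableT_comp (measurable_funPT (f (inr B)))).
  apply: measurable_fun_pair; last exact: mcoord.
  exact: measurable_cst.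
pose arg v (yn : product_space X * noise R (V + latent G)%type) :
    parent_space D (sum_family X Z) (inl v) * Y (inl v) :=
  (fun u => full yn (val u), g (inl v) (yn.2 (inl v))).
have marg v : measurable_fun setT (@arg v).
  apply: measurable_fun_pair; last exact: mcoord.
  by apply: measurable_to_product => u; exact: mfull.
have meta w : measurable_fun setT (phi w \o E w \o r).
  by apply: measurableT_comp mr; apply: measurableT_comp => //; case: (gP w).
pose eta w : {mfun Om >-> real_space R} := mfun_of (meta w).
have mx v : measurable_fun setT (x (inl v) \o r) by exact: measurableT_comp.
pose x' v : {mfun Om >-> X v} := mfun_of (mx v).
pose S (w : V + latent G) : {set V} :=
  match w with inl v => [set v]%SET | inr B => val B end.
pose f' v : {mfun (product_space X * noise R (V + latent G)%type)%type >-> X v} :=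
  mfun_of (measurableT_comp (measurable_funPT (f (inl v))) (marg v)).
exists Om, mu, (V + latent G)%type, S, eta, f', x'; split.
- split => // v; apply: standard_probability_ext (stx (inl v)) => B mB.
  by apply/esym; apply: (mur (x (inl v) @^-1` B)); exact: measurable_funPTI.
- move=> J B mB.
  have mEB w : measurable (E w @^-1` (phi w @^-1` B w)).
    by apply: measurable_funPTI; apply: measurable_preimage => //; case: (gP w).
  transitivity (mu (r @^-1` \bigcap_(w in [set` J]) (E w @^-1` (phi w @^-1` B w)))).
    by congr (mu _).
  rewrite mur; last by apply: fin_bigcap_measurable; first exact: finite_finset.
  rewrite Ei; last by move=> w; apply: measurable_preimage => //; case: (gP w).
  by apply: eq_bigr => w _; apply/esym/(mur _ (mEB w)).
- move=> [v|B] /=; right; first by case: (faces_complex G) => _ + _; exact.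
  by have := valP B; rewrite inE => /andP[+ _]; rewrite inE => /maxsetp.
- split.
    move=> v y y' n n' yy' nn'.
    suff arg_eq : arg v (y, n) = arg v (y', n') by rewrite /f' /= arg_eq.
    rewrite /arg; congr pair.
      apply: functional_extensionality_dep => -[[u|B] /=]; rewrite inE /= => h; first exact: yy'.
      by rewrite /= nn'.
    by rewrite /= nn'// inE.
  move=> v t; transitivity (x (inl v) (r t)) => //; rewrite xE.
  suff arg_eq : ((fun u => x (val u) (r t)) : parent_space D (sum_family X Z) (inl v),
      E (inl v) (r t)) = arg v ((fun u => x' u t) : product_space X, observe eta t).
    by rewrite arg_eq.
  have gE w : g w (phi w (E w (r t))) = E w (r t).
    by case: (gP w) => _ _ _ _ ->//; apply: (rO t); rewrite /= inE.
  rewrite /arg; congr pair; last exact/esym/gE.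
  apply: functional_extensionality_dep => -[[u|B] h] //=.
  have p0E : p0 B = fun u => x (val u) (r t).
    by apply: functional_extensionality_dep => -[[] u hu]; exfalso; move: hu; rewrite inE.
  by rewrite xE /observe /= gE p0E.
- move=> B mB; rewrite PE// QE; last first.
    apply: (measurable_preimage _ mB); apply: measurable_to_product => u.
    exact: (@measurable_coordinate _ (sum_family X Z) (inl u)).
  apply/esym; apply: (mur [set o | B (fun v => x (inl v) o)]).
  apply: (measurable_preimage _ mB); apply: measurable_to_product => u.
  exact: measurable_funPT.
Qed.

End NormalForm.

(** * Ancestor rank and the faces of the split complex *)

Section Rank.
Context (V : finType) (G : dag V).

(** The number of ancestors increases strictly along edges, which makes it a topological order for
    the inductions. *)
Definition rank (v : V) : nat := #|[set u | connect G u v]%SET|.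

Lemma edge_not_connect u v : G u v -> ~~ connect G v u.
Proof.
move=> uv; apply/negP => /connectP[p vp up].
have /negP := @edge_acyclic _ G _ (isT : v :: p != [::]); apply.
by rewrite /cycle rcons_path vp -up.
Qed.

Lemma rank_edge u v : G u v -> (rank u < rank v)%N.
Proof.
move=> uv; apply: proper_card; rewrite properE; apply/andP; split.
  apply/fintype.subsetP => t; rewrite !inE => tu.
  exact: connect_trans tu (connect1 uv).
apply/negP => /fintype.subsetP/(_ v); rewrite !inE fingraph.connect0 => /(_ isT).
exact/negP/edge_not_connect.
Qed.

End Rank.

Section SplitFaces.
Context (V : finType) (G : mdag V) (B C D : {set V}).
Hypothesis facetB : B \in facets G.
Hypothesis B_CD : B = (C :|: D)%SET.
Hypothesis disjCD : [disjoint C & D]%B.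
Hypothesis hi : forall (c : V) (F : {set V}),
  c \in C -> F \in faces G -> c \in F -> F \subset B.

Lemma facetB_face : B \in faces G.
Proof. by move: facetB; rewrite inE => /maxsetp. Qed.

Lemma sub_CB : C \subset B. Proof. by rewrite B_CD finset.subsetUl. Qed.

Lemma sub_DB : D \subset B. Proof. by rewrite B_CD finset.subsetUr. Qed.

Lemma split_face_face A : A \in split_faces G B C D -> A \in faces G.
Proof.
have [_ single down] := faces_complex G.
rewrite inE => /andP[A0 /or4P[/cards1P[v ->]|AC|AD|/exists_inP[F FG /andP[_ AF]]]].
- exact: single.
- exact: down facetB_face (fintype.subset_trans AC sub_CB) A0.
- exact: down facetB_face (fintype.subset_trans AD sub_DB) A0.
- by apply: down AF A0; move: FG; rewrite inE => /maxsetp.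
Qed.

(** A facet other than [B] cannot contain [c]: by [hi] it would lie in [B], hence equal [B] by
    maximality. *)
Lemma split_face_meets A c : A \in split_faces G B C D -> c \in A -> c \in C -> A \subset C.
Proof.
rewrite inE => /andP[A0 /or4P[/cards1P[v ->]|//|AD|/exists_inP[F FG /andP[FB AF]]]] cA cC.
- by move: cA; rewrite inE => /eqP <-; rewrite finset.sub1set.
- have := fintype.subsetP AD _ cA.
  by move: disjCD; rewrite disjoint_subset => /fintype.subsetP/(_ _ cC); rewrite inE => /negP.
- move: FG; rewrite inE => mxF; case/eqP: FB; apply: esym.
  apply: (maxsetsup mxF); first exact: facetB_face.
  exact: hi cC (maxsetp mxF) (fintype.subsetP AF _ cA).
Qed.

Lemma face_split_face A : A \in faces G -> A != finset.set0 -> [disjoint A & C]%B ->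
  A \in split_faces G B C D.
Proof.
move=> AG A0 AC; have [F mxF AF] := maxset_exists AG.
rewrite inE A0 /=; have [FB|FB] := eqVneq F B; last first.
  by apply/or4P/Or44; apply/exists_inP; exists F; rewrite ?inE ?FB ?AF.
apply/or4P/Or43; apply/fintype.subsetP => v vA.
have := fintype.subsetP AF _ vA; rewrite FB B_CD finset.inE => /orP[vC|//].
by move: AC; rewrite disjoint_subset => /fintype.subsetP/(_ _ vA); rewrite inE vC.
Qed.

End SplitFaces.

(** * From the split graph back to [G] *)

Section Merge.
Context (R : realType) (V : finType) (G : mdag V) (B C D : {set V}) (X : V -> state_space).
Hypothesis facetB : B \in facets G.
Hypothesis B_CD : B = (C :|: D)%SET.
Hypothesis disjCD : [disjoint C & D]%B.
Hypothesis hi : forall (c : V) (F : {set V}),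
  c \in C -> F \in faces G -> c \in F -> F \subset B.
Hypothesis hii : forall d : V, d \in D -> parents_of G C \subset parents G d.

Lemma CD_notin v : v \in C -> v \in D -> False.
Proof.
by move=> vC vD; move: disjCD; rewrite disjoint_subset => /fintype.subsetP/(_ _ vC); rewrite inE vD.
Qed.

Lemma parent_CD u c v : G u c -> c \in C -> v \in D -> G u v.
Proof.
move=> uc cC vD; have : u \in parents G v; last by rewrite inE.
by apply: (fintype.subsetP (hii vD)); apply/bigcupP; exists c; rewrite ?inE.
Qed.

(* A vertex of [D] recomputes the values of its new parents in [C] from
   [pa(C)] and the noise seen by [C], which it now sees too. *)
Lemma merge_noise_model P :
  @noise_model R V X (split_edge G C D) (split_faces G B C D) P ->
  @noise_model R V X G (faces G) P.
Proof.
move=> [Om [mu [I [S [eta [f [x [[stmu stx] etai SF [floc xE] PE]]]]]]]].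
(* By [split_face_meets], noise seen somewhere in [C] is seen only inside [C]; it is now shown to
   all of [B]. *)
pose S' i := if [disjoint S i & C]%B then S i else B.
have SS' i : S i \subset S' i.
  rewrite /S'; case: ifPn => // /pred0Pn[c /andP[/= cS cC]].
  case: (SF i) => [S0|Sf]; first by rewrite S0 inE in cS.
  apply: fintype.subset_trans (sub_CB B_CD).
  exact: (split_face_meets facetB disjCD hi Sf cS cC).
have S'c i c v : c \in S i -> c \in C -> v \in D -> v \in S' i.
  move=> cS cC vD; rewrite /S'; case: ifPn => [|_].
    by rewrite disjoint_subset => /fintype.subsetP/(_ _ cS); rewrite inE cC.
  by rewrite B_CD finset.inE vD orbT.
(* One round of recomputation is enough: a vertex of [C] that is a parent of another vertex of [C]
   is, by [hii], already a parent in [G] of every vertex of [D]. *)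
pose fill (yn : product_space X * noise R I) : product_space X :=
  fun u => if u \in C then f u yn else yn.1 u.
have mfill : measurable_fun setT fill.
  apply: measurable_to_product => u; rewrite /fill; case: (u \in C) => //.
  exact: (measurableT_comp (@measurable_coordinate _ X u) measurable_fst).
have mfilled v : measurable_fun setT (fun yn => f v (fill yn, yn.2)).
  by apply: measurableT_comp => //; apply: measurable_fun_pair.
pose f' v : {mfun (product_space X * noise R I)%type >-> X v} :=
  if v \in D then mfun_of (mfilled v) else f v.
exists Om, mu, I, S', eta, f', x; split => //.
- move=> i; rewrite /S'; case: ifPn => _; last by right; exact: facetB_face.
  by case: (SF i) => [|/(split_face_face facetB B_CD)]; [left|right].
- have floc' v y y' n n' : v \notin D -> (forall u, G u v -> y u = y' u) ->
      (forall i, v \in S i -> n i = n' i) -> f v (y, n) = f v (y', n').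
    move=> vD yy' nn'; apply: floc => // u; rewrite /split_edge (negbTE vD) andbF orbF.
    exact: yy'.
  split=> v.
    move=> y y' n n' yy' nn'; rewrite /f'; case: ifPn => vD; last first.
      by apply: floc' => // i /(fintype.subsetP (SS' i)); exact: nn'.
    rewrite /=; apply: floc => [u|i /(fintype.subsetP (SS' i))]; last exact: nn'.
    rewrite /split_edge vD andbT /fill => uv; case: ifPn uv => [uC _|_ /orP[|//]]; last exact: yy'.
    apply: floc' => [|t tu|i uS]; first by apply/negP => /(CD_notin uC).
      by apply: yy'; exact: parent_CD tu uC vD.
    by apply: nn'; exact: S'c uS uC vD.
  move=> w; rewrite /f'; case: ifPn => vD; last exact: xE.
  rewrite xE /=; congr (f v (_, _)); apply/functional_extensionality_dep => u.
  by rewrite /fill /=; case: ifP => // _; exact: xE.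
Qed.

End Merge.

Lemma cond_indep_comp (R : realType) d (T : measurableType d) (mu : probability T R)
    dU dU' dE dS (TU : measurableType dU) (TU' : measurableType dU')
    (TE : measurableType dE) (TS : measurableType dS)
    (U : T -> TU) (E : T -> TE) (S : T -> TS) (h : TU -> TU') :
  measurable_fun setT h -> cond_indep mu U E S -> cond_indep mu (h \o U) E S.
Proof. by move=> mh UES a ma; apply: (UES (h @^-1` a)); exact: measurable_preimage. Qed.

(** * Adjoining an independent uniform variable *)

Section Extension.
Context (R : realType) (Om : state_space) (mu : probability Om R) (I : finType)
  (eta : forall i : I, {mfun Om >-> real_space R}).

Definition extended_space : state_space := StateSpace (Om * R)%type.

Definition extended_noise (o : option I) : {mfun extended_space >-> real_space R} :=
  match o with
  | Some i => mfun_of (measurableT_comp (measurable_funPT (eta i)) measurable_fst)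
  | None => mfun_of (@measurable_snd _ _ Om R)
  end.

Lemma extended_independent : independent mu eta ->
  independent (product_probability mu : probability extended_space R) extended_noise.
Proof.
move=> etai J A mA.
pose J1 := [set i | Some i \in J]%SET.
pose E1 := \bigcap_(i in [set` J1]) (eta i @^-1` A (Some i)).
pose E2 := if None \in J then A None else setT.
have mE1 : measurable E1.
  apply: fin_bigcap_measurable; first exact: finite_finset.
  by move=> i _; exact: measurable_funPTI.
have mE2 : measurable E2 by rewrite /E2; case: ifP.
have rectE X Y : measurable X -> measurable Y ->
    product_probability mu (X `*` Y) = mu X * unif R Y.
  by move=> mX mY; exact: product_measure1E.
rewrite [X in product_probability mu X](_ : _ = E1 `*` E2); last first.
  apply/seteqP; split => z.
    move=> h; split; first by move=> i; rewrite /= inE => Ji; exact: (h (Some i)).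
    by rewrite /E2; case: ifPn => // NJ; exact: (h None).
  move=> [h1 h2] [i|] /= oJ; first by apply: (h1 i); rewrite /= inE.
  by move: h2; rewrite /E2 oJ.
rewrite rectE// etai//.
rewrite [RHS]big_mkcond (bigD1 None)//= muleC; congr (_ * _).
  rewrite /E2; case: ifPn => _; last exact: probability_setT.
  rewrite [X in product_probability mu X](_ : _ = setT `*` A None).
    by rewrite rectE// probability_setT mul1e.
  by apply/seteqP; split => z //= [].
rewrite (reindex_omap Some id)/=; last by case.
rewrite big_mkcond [RHS]big_mkcond; apply: eq_bigr => i _.
rewrite eqxx inE; case: ifP => // _.
rewrite [X in product_probability mu X](_ : _ = (eta i @^-1` A (Some i)) `*` setT).
  by rewrite rectE// ?probability_setT ?mule1//; exact: measurable_funPTI.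
by apply/seteqP; split => z //= [].
Qed.

End Extension.

(** * Splitting the facet *)

Section Split.
Context (R : realType) (V : finType) (G : mdag V) (B C D : {set V}) (X : V -> state_space).
Hypothesis B_CD : B = (C :|: D)%SET.
Hypothesis disjCD : [disjoint C & D]%B.
Hypothesis hi : forall (c : V) (F : {set V}),
  c \in C -> F \in faces G -> c \in F -> F \subset B.
Hypothesis hii : forall d : V, d \in D -> parents_of G C \subset parents G d.

Definition downstream (v : V) : bool := [exists d in D, connect G d v].

Lemma downstream_edge u v : G u v -> downstream u -> downstream v.
Proof.
move=> uv /exists_inP[d dD du]; apply/exists_inP; exists d => //.
exact: connect_trans du (connect1 uv).
Qed.

Lemma downstream_D v : v \in D -> downstream v.
Proof. by move=> vD; apply/exists_inP; exists v => //; exact: fingraph.connect0. Qed.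

(** By [hii], [u] is a parent of every vertex of [D], so a path from [D] to [u] would close a
    cycle. *)
Lemma parent_not_downstream u c : c \in C -> G u c -> ~~ downstream u.
Proof.
move=> cC uc; apply/negP => /exists_inP[d dD].
exact/negP/edge_not_connect/(parent_CD hii uc cC dD).
Qed.

Lemma C_not_downstream c : c \in C -> ~~ downstream c.
Proof.
move=> cC; apply/negP => /exists_inP[d dD /connectP[p]].
elim/last_ind: p => [_ cd|p y _]; first by move: cC; rewrite cd => /(CD_notin disjCD)/(_ dD).
rewrite rcons_path last_rcons => /andP[dp py] cy; rewrite -cy in py.
have /negP := parent_not_downstream cC py; apply.
by apply/exists_inP; exists d => //; apply/connectP; exists p.
Qed.

Definition conditioning (v : V) : bool := (v \in C) || (v \in parents_of G C).

Lemma conditioning_parent u c : c \in C -> G u c -> conditioning u.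
Proof.
by move=> cC uc; apply/orP; right; apply/bigcupP; exists c; rewrite ?inE.
Qed.

Lemma conditioning_not_downstream v : conditioning v -> ~~ downstream v.
Proof.
case/orP => [|/bigcupP[c cC]]; first exact: C_not_downstream.
by rewrite inE; exact: parent_not_downstream.
Qed.

Context (Om : state_space) (mu : probability Om R) (I : finType) (S : I -> {set V})
  (eta : forall i : I, {mfun Om >-> real_space R})
  (f : forall v, {mfun (product_space X * noise R I)%type >-> X v})
  (x : forall v, {mfun Om >-> X v}).
Hypothesis etai : independent mu eta.
Hypothesis SF : forall i, S i = finset.set0 \/ S i \in faces G.
Hypothesis floc : forall v, local_at G S (f v).
Hypothesis xE : forall v w, x v w = f v ((fun u => x u w) : product_space X, observe eta w).

Definition meets_C (i : I) : bool := ~~ [disjoint S i & C]%B.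

Lemma meets_CP i c : c \in S i -> c \in C -> meets_C i.
Proof. by move=> cS cC; apply/pred0Pn; exists c; rewrite /= cS. Qed.

Lemma meets_C_sub i : meets_C i -> S i \subset B.
Proof.
move=> /pred0Pn[c /andP[/= cS cC]]; case: (SF i) => [S0|Si].
  by rewrite S0 inE in cS.
exact: hi cC Si cS.
Qed.

Lemma not_meets_C i v : v \in S i -> v \notin C -> v \notin D -> ~~ meets_C i.
Proof.
move=> vS vC vD; apply/negP => /meets_C_sub/fintype.subsetP/(_ _ vS).
by rewrite B_CD finset.inE (negbTE vC) (negbTE vD).
Qed.

(** Values on [C] are prescribed by [s] instead of computed, because the noise [n] may carry a
    redrawn part in place of the noise that produced them. *)
Definition solve_step (s : product_space X) (n : noise R I) (y : product_space X) :
    product_space X :=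
  fun v => if v \in C then s v else f v (y, n).

Definition solve (m : nat) (s : product_space X) (n : noise R I) : product_space X :=
  iter m (solve_step s n) s.

Lemma measurable_solve m :
  measurable_fun setT (fun sn : product_space X * noise R I => solve m sn.1 sn.2).
Proof.
elim: m => [|m IH] /=; first exact: measurable_fst.
apply: measurable_to_product => v; rewrite /solve_step; case: (v \in C).
  exact: (measurableT_comp (@measurable_coordinate _ X v) measurable_fst).
apply: (measurableT_comp (measurable_funPT (f v))).
by apply: measurable_fun_pair.
Qed.

(** A vertex outside [C] and [D] sees no noise seen by [C], so only downstream vertices need the
    true noise. The bound on [rank G c] allows [s] to know [C] only up to the rank of [v], as in the
    induction for [noise_cond_indep]. *)
Lemma solve_correct m s n w v : (rank G v < m)%N ->
  (forall c, c \in C -> (rank G c <= rank G v)%N -> s c = x c w) ->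
  (forall i, ~~ meets_C i -> n i = eta i w) ->
  (downstream v -> n = observe eta w) ->
  solve m s n v = x v w.
Proof.
elim: m v => // m IH v; rewrite ltnS => vm sx nC nD.
rewrite /= /solve_step; case: ifPn => [vC|vC]; first exact: sx.
rewrite xE; apply: floc => [u uv|i vS].
  have uv_rank := rank_edge uv.
  apply: IH => //; first exact: leq_trans uv_rank vm.
    by move=> c cC cu; apply: sx => //; exact: leq_trans cu (ltnW uv_rank).
  by move/(downstream_edge uv).
have [dv|dv] := boolP (downstream v); first by rewrite nD.
by apply: nC; apply: not_meets_C vS vC _; apply: contra dv; exact: downstream_D.
Qed.

Lemma solve_stable m s n v : (rank G v < m)%N -> solve m.+1 s n v = solve m s n v.
Proof.
elim: m v => // m IH v; rewrite ltnS => vm.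
rewrite [LHS]/= [RHS]/= /solve_step; case: ifP => // _.
by apply: floc => // u /rank_edge uv; apply: IH; exact: leq_trans uv vm.
Qed.

Definition height : nat := #|V|.+1.

Lemma rank_height v : (rank G v < height)%N.
Proof. by rewrite ltnS max_card. Qed.

Lemma solve_fix s n v : v \notin C -> solve height s n v = f v (solve height s n, n).
Proof.
move=> vC; rewrite -solve_stable ?rank_height//.
by rewrite {1}/solve iterS {1}/solve_step (negbTE vC).
Qed.

Definition noise_C : {mfun Om >-> noise R I} := masked eta meets_C.
Definition noise_rest : {mfun Om >-> noise R I} := masked eta (predC meets_C).

Context (x0 : product_space X).

Definition restrict_to (A : pred V) (y : product_space X) : product_space X :=
  fun v => if A v then y v else x0 v.

Lemma measurable_restrict_to A : measurable_fun setT (restrict_to A).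
Proof.
apply: measurable_to_product => v; rewrite /restrict_to; case: (A v) => //.
exact: (@measurable_coordinate _ X v).
Qed.

Lemma measurable_observed A : measurable_fun setT (fun w => restrict_to A (fun v => x v w)).
Proof.
apply: (measurableT_comp (measurable_restrict_to A)).
by apply: measurable_to_product => v; exact: measurable_funPT.
Qed.

Definition observed A : {mfun Om >-> product_space X} := mfun_of (measurable_observed A).

Lemma restrict_to_observed (A A' : pred V) w : (forall v, A v -> A' v) ->
  restrict_to A (observed A' w) = observed A w.
Proof.
move=> AA'; apply/functional_extensionality_dep => v.
rewrite /= /restrict_to; by case: ifP => // /AA' ->.
Qed.

Definition conditioning_below (n : nat) : pred V := fun v => conditioning v && (rank G v < n)%N.

(* Observing a new vertex of [C], a function of [noise_C] and of what is
   observed already, or a new vertex of [pa(C)], a function of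
   [noise_rest] and of what is observed already, preserves their
   conditional independence. *)
Lemma noise_cond_indep n : cond_indep mu noise_C noise_rest (observed (conditioning_below n)).
Proof.
elim: n => [|n IH].
  have -> : (observed (conditioning_below 0) : Om -> product_space X) = fun=> x0.
    apply/funext => w; apply/functional_extensionality_dep => v.
    by rewrite /= /restrict_to /conditioning_below ltn0 andbF.
  apply: cond_indep_cst => a e ma me; apply: masked_independent2 => // i.
  by rewrite /= andbN.
(* Rank [n] is added in two stages: first its vertices in [C], then those of pa(C). *)
pose A' : pred V := fun v => conditioning_below n v || (v \in C) && (rank G v <= n)%N.
have AA' v : conditioning_below n v -> A' v by rewrite /A' => ->.
have A'A v : A' v -> conditioning_below n.+1 v.
  rewrite /A' => /orP[/andP[Kv vn]|/andP[vC vn]].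
    by apply/andP; split => //; rewrite ltnS ltnW.
  by apply/andP; split; [rewrite /conditioning vC|rewrite ltnS].
have UES' : cond_indep mu noise_C noise_rest (observed A').
  (* Refinement lets the observation grow by functions of the second variable only, so [noise_C] is
     moved to that place. *)
  apply: cond_indep_sym.
  pose k (su : product_space X * noise R I) : product_space X := fun v =>
    if A' v then if conditioning_below n v then su.1 v else f v su else x0 v.
  apply: (cond_indep_refine (r := restrict_to (conditioning_below n)) (k := k) _ _ _ _
    (cond_indep_sym IH)).
  - exact: measurable_restrict_to.
  - apply: measurable_to_product => v; rewrite /k; case: (A' v) => //.
    case: (conditioning_below n v) => //.
    exact: (measurableT_comp (@measurable_coordinate _ X v) measurable_fst).
  - by move=> w; rewrite restrict_to_observed.
  - move=> w; apply/functional_extensionality_dep => v.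
    rewrite /k /= {1}/restrict_to; case: ifP => // A'v.
    case: ifP => [Av|nAv]; first by rewrite /restrict_to Av.
    have [vC vn] : v \in C /\ (rank G v <= n)%N.
      by move: A'v; rewrite /A' nAv /= => /andP[].
    rewrite xE; apply: floc => [u uv|i vS].
      rewrite /restrict_to (_ : conditioning_below n u)//.
      apply/andP; split; first exact: conditioning_parent vC uv.
      exact: leq_trans (rank_edge uv) vn.
    by rewrite /mask_noise (meets_CP vS vC).
(* Unlike a vertex of [C], a vertex of pa(C) may have unobserved parents; [solve] rebuilds its
   ancestors from [noise_rest] and the observed values of [C]. *)
pose k (se : product_space X * noise R I) : product_space X := fun v =>
  if A' v then se.1 v else
  if conditioning_below n.+1 v then solve n.+1 se.1 se.2 v else x0 v.
apply: (cond_indep_refine (r := restrict_to A') (k := k) _ _ _ _ UES').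
- exact: measurable_restrict_to.
- apply: measurable_to_product => v; rewrite /k; case: (A' v).
    exact: (measurableT_comp (@measurable_coordinate _ X v) measurable_fst).
  case: (conditioning_below n.+1 v) => //.
  exact: (measurableT_comp (@measurable_coordinate _ X v) (measurable_solve n.+1)).
- by move=> w; rewrite restrict_to_observed.
- move=> w; apply/functional_extensionality_dep => v.
  rewrite /k; have [A'v|nA'v] := boolP (A' v).
    by rewrite /= /restrict_to (A'A _ A'v) A'v.
  rewrite [LHS]/= {1}/restrict_to.
  case: ifPn => // /andP[Kv vn]; apply/esym/solve_correct => //.
  + move=> c cC cv; rewrite /= /restrict_to /A' cC /=.
    by rewrite (leq_trans cv) ?orbT.
  + by move=> i nCi; rewrite /= /mask_noise /= nCi.
  + by rewrite (negbTE (conditioning_not_downstream Kv)).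
Qed.

Lemma conditioning_belowE v : conditioning_below height v = conditioning v.
Proof. by rewrite /conditioning_below rank_height andbT. Qed.

Definition merge_noise (u e : noise R I) : noise R I :=
  fun i => if meets_C i then u i else e i.

Lemma measurable_merge_noise :
  measurable_fun setT (fun ue : noise R I * noise R I => merge_noise ue.1 ue.2).
Proof.
apply: measurable_to_product => i; rewrite /merge_noise; case: (meets_C i).
  exact: (measurableT_comp (@measurable_coordinate _ (fun=> real_space R) i) measurable_fst).
exact: (measurableT_comp (@measurable_coordinate _ (fun=> real_space R) i) measurable_snd).
Qed.

Lemma split_noise_model (P : probability (product_space X) R) :
  standard_probability mu -> (forall v, standard_probability (distribution mu (x v))) ->
  (forall A : set (product_space X), measurable A -> P A = mu [set w | A (fun v => x v w)]) ->
  noise_model (split_edge G C D) (split_faces G B C D) P.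
Proof.
move=> stmu stx PE.
have [enc [dec [menc mdec enc01 encK]]] := noise_encoding R I.
(* Every rank is below [height], so [K] is all of C and pa(C). *)
pose K := conditioning_below height.
pose SK := observed K.
have mencU : measurable_fun setT (enc \o noise_C) by exact: measurableT_comp.
have [g [mg gE]] := conditional_resampling (U := mfun_of mencU) (fun w => enc01 (noise_C w))
  (cond_indep_comp menc (noise_cond_indep height)).
pose phi (z : (product_space X * noise R I) * R) : product_space X :=
  solve height z.1.1 (merge_noise (dec z.2) z.1.2).
have mphi : measurable_fun setT phi.
  apply: (measurableT_comp (f := fun sn : product_space X * noise R I => solve height sn.1 sn.2)
    (g := fun z : (product_space X * noise R I) * R => (z.1.1, merge_noise (dec z.2) z.1.2))).
    exact: measurable_solve.
  apply: measurable_fun_pair; first exact: (measurableT_comp measurable_fst measurable_fst).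
  apply: (measurableT_comp (f := fun ue : noise R I * noise R I => merge_noise ue.1 ue.2)
    (g := fun z : (product_space X * noise R I) * R => (dec z.2, z.1.2))).
    exact: measurable_merge_noise.
  apply: measurable_fun_pair; first exact: (measurableT_comp mdec measurable_snd).
  exact: (measurableT_comp measurable_snd measurable_fst).
pose args (z : Om * R) := ((SK z.1, noise_rest z.1), g (SK z.1, z.2)).
have margs : measurable_fun setT args.
  have m1 T (d : measure_display) (T' : measurableType d) (Y : {mfun Om >-> T'}) :
      measurable_fun setT (fun z : Om * R => Y z.1) by exact: measurableT_comp.
  apply: measurable_fun_pair; first by apply: measurable_fun_pair; exact: measurableT_comp.
  by apply: (measurableT_comp mg); apply: measurable_fun_pair => //; exact: measurableT_comp.
have mx' v : measurable_fun setT (fun z => phi (args z) v : X v).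
  exact: (measurableT_comp (@measurable_coordinate _ X v) (measurableT_comp mphi margs)).
pose x' v : {mfun extended_space R Om >-> X v} := mfun_of (mx' v).
(* In [phi], the redrawn code has the same joint law with the other arguments as the code of
   [noise_C], for which [phi] returns the original values [x]. *)
have law (A : set (product_space X)) : measurable A ->
    P A = product_probability mu [set z | A (phi (args z))].
  move=> mA; rewrite PE//.
  have := gE (phi @^-1` A) (measurable_preimage mphi mA).
  rewrite [X in X = _](_ : _ = product_probability mu [set z | A (phi (args z))])// => ->.
  congr (mu _); apply/seteqP.
  have xphi w : (fun v => x v w) = phi ((SK w, noise_rest w), enc (noise_C w)).
    apply/functional_extensionality_dep => v; apply/esym/solve_correct.
    - exact: rank_height.
    - move=> c cC _; rewrite /= /restrict_to [K c]conditioning_belowE.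
      by rewrite /conditioning cC.
    - by move=> i nCi; rewrite /= /merge_noise (negbTE nCi) /= /mask_noise /= nCi.
    - move=> _; apply/funext => i; rewrite /= encK /merge_noise /= /mask_noise /=.
      by case: (meets_C i).
  by split => w; rewrite /mkset xphi; exact: id.
(* Noise seen by [C] is withdrawn from [D], which shares the fresh uniform variable [None]
   instead. *)
pose S' (o : option I) : {set V} :=
  if o is Some i then if meets_C i then (S i :&: C)%SET else S i else D.
pose unpack (n : noise R (option I)) : noise R I := fun i => n (Some i).
have munpack : measurable_fun setT unpack.
  apply: measurable_to_product => i.
  exact: (@measurable_coordinate _ (fun=> real_space R) (Some i)).
pose redraw (yn : product_space X * noise R (option I)) : noise R I :=
  merge_noise (dec (g (restrict_to K yn.1, yn.2 None))) (unpack yn.2).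
have mredraw : measurable_fun setT redraw.
  apply: (measurableT_comp (f := fun ue : noise R I * noise R I => merge_noise ue.1 ue.2)
    (g := fun yn : product_space X * noise R (option I) =>
      (dec (g (restrict_to K yn.1, yn.2 None)), unpack yn.2))).
    exact: measurable_merge_noise.
  apply: measurable_fun_pair; last exact: (measurableT_comp munpack measurable_snd).
  apply: (measurableT_comp mdec); apply: (measurableT_comp mg).
  apply: measurable_fun_pair.
    exact: (measurableT_comp (measurable_restrict_to K) measurable_fst).
  exact: (measurableT_comp (@measurable_coordinate _ (fun=> real_space R) None) measurable_snd).
have mfD v : measurable_fun setT (fun yn : product_space X * noise R (option I) =>
    f v (yn.1, redraw yn)).
  by apply: (measurableT_comp (measurable_funPT (f v))); apply: measurable_fun_pair.
have mfnD v : measurable_fun setT (fun yn : product_space X * noise R (option I) =>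
    f v (yn.1, unpack yn.2)).
  apply: (measurableT_comp (measurable_funPT (f v))); apply: measurable_fun_pair => //.
  exact: (measurableT_comp munpack measurable_snd).
pose f' v : {mfun (product_space X * noise R (option I))%type >-> X v} :=
  if v \in D then mfun_of (mfD v) else mfun_of (mfnD v).
exists (extended_space R Om), (product_probability mu), (option I), S',
  (extended_noise eta), f', x'.
split.
- split; first exact: standard_probability_product.
  (* The new variables have joint law [P] as well, so their margins are the old standard ones. *)
  move=> v; apply: standard_probability_ext (stx v) => A mA.
  pose A' : set (product_space X) := [set y | A (y v)].
  have mA' : measurable A' by exact: (measurable_preimage (@measurable_coordinate _ X v) mA).
  by rewrite /distribution /pushforward; transitivity (P A'); [rewrite PE|rewrite law].
- exact: extended_independent.
- move=> [i|] /=; last first.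
    have [->|D0] := eqVneq D finset.set0; [by left|right].
    by rewrite inE D0 /=; apply/or4P/Or43.
  case: ifPn => [iC|/negPn iC].
    right; rewrite inE; apply/andP; split; last by apply/or4P/Or42; exact: finset.subsetIr.
    have /pred0Pn[c /andP[/= cS cC]] := iC.
    by apply/set0Pn; exists c; rewrite inE cS.
  case: (SF i) => [|Si]; first by left.
  have [->|S0] := eqVneq (S i) finset.set0; [by left|right].
  exact: (face_split_face B_CD).
- have S'C i v : v \in S i -> v \notin D -> v \in S' (Some i).
    move=> vS vD; rewrite /S'; case: ifPn => // iC; rewrite inE vS /=.
    by apply: contraT => vC; have := not_meets_C vS vC vD; rewrite iC.
  split=> v.
    move=> y y' n n' yy' nn'; rewrite /f'; case: ifPn => vD; last first.
      by apply: floc => [u uv|i vS]; [apply: yy'; rewrite /split_edge uv|exact/nn'/S'C].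
    have yy'K : restrict_to K y = restrict_to K y'.
      apply/functional_extensionality_dep => u; rewrite /restrict_to [K u]conditioning_belowE.
      case: ifP => // /orP[uC|/bigcupP[c cC]]; last rewrite inE => uc.
        by apply: yy'; rewrite /split_edge uC vD orbT.
      by apply: yy'; rewrite /split_edge (parent_CD hii uc cC vD).
    rewrite /= /redraw /= yy'K (nn' None)//; apply: floc => [u uv|i vS].
      by apply: yy'; rewrite /split_edge uv.
    rewrite /merge_noise; case: ifPn => // iC; apply: nn'.
    by rewrite /S' (negbTE iC).
  move=> z; pose n' := merge_noise (dec (args z).2) (noise_rest z.1).
  have x'E u : x' u z = solve height (SK z.1) n' u by [].
  (* C and pa(C) keep their values, so a vertex of [D] reads from its parents exactly the
     conditioning value used in [args]. *)
  have x'K u : conditioning u -> x' u z = x u z.1.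
    move=> Ku; rewrite x'E; apply: solve_correct.
    - exact: rank_height.
    - by move=> c cC _; rewrite /= /restrict_to [K c]conditioning_belowE /conditioning cC.
    - by move=> i nCi; rewrite /n' /merge_noise (negbTE nCi) /= /mask_noise /= nCi.
    - by rewrite (negbTE (conditioning_not_downstream Ku)).
  rewrite /f'; case: ifPn => vD.
    rewrite x'E solve_fix; last by apply/negP => /(CD_notin disjCD)/(_ vD).
    rewrite /= /redraw; congr (f v (_, _)).
    rewrite /n' /=; apply/funext => i; rewrite /merge_noise; case: ifPn => iC.
      congr (dec (g (_, _)) i); apply/functional_extensionality_dep => u.
      rewrite /= /restrict_to [K u]conditioning_belowE; case: ifP => // Ku.
      by rewrite -x'K.
    by rewrite /= /mask_noise /= iC.
  (* On [C] the old equation survives with the true noise, since all parents of [C] are unchanged;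
     elsewhere outside [D] the redrawn noise is not seen. *)
  have [vC|vC] := boolP (v \in C).
    rewrite x'K; last by rewrite /conditioning vC.
    rewrite xE /=; apply: floc => // u uv.
    by rewrite -x'K//; exact: conditioning_parent vC uv.
  rewrite x'E solve_fix//=; apply: floc => // i vS.
  have iC := not_meets_C vS vC vD.
  by rewrite /n' /merge_noise (negbTE iC) /= /mask_noise /= iC.
- exact: law.
Qed.

End Split.

Local Close Scope ereal_scope.
Local Close Scope ring_scope.
Local Close Scope classical_set_scope.

Theorem proposition6p1 (R : realType) (V : finType) (G : mdag V)
    (B C D : {set V})
    (facetB : B \in facets G)
    (B_CD : B = (C :|: D)%SET)
    (disjCD : [disjoint C & D])
    (hi : forall (c : V) (F : {set V}),
        c \in C -> F \in faces G -> c \in F -> F \subset B)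
    (hii : forall d : V, d \in D -> parents_of G C \subset parents G d)
    (X : V -> state_space) :
  marginal_model R G X
    = marginal_model R (split_mdag B disjCD hii) X.
Proof.
apply/seteqP; split => P.
  move=> /marginal_to_noise[Om [mu [I [S [eta [f [x]]]]]]].
  move=> [[stmu stx] etai SF [floc xE] PE].
  (* Any sample point provides the default values [x0] for unobserved vertices. *)
  have [w _] := probability_inhabited (probability_setT mu).
  apply: noise_to_marginal.
  exact: (split_noise_model B_CD disjCD hi hii etai SF floc xE
    (fun v => x v w) stmu stx PE).
move=> /marginal_to_noise mP; apply: noise_to_marginal.
exact: (merge_noise_model facetB B_CD disjCD hi hii mP).
Qed.
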